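(* Let $X$ be an infinite dimensional complex Banach space and let $T\in L(X)$. Suppose that there exist two pairs $(M,N)$ and $(M',N')$ of closed $T$-invariant subspaces of $X$ such that $M\oplus N=M'\oplus N'$ is closed, $T_M$ and $T_{M'}$ are semi-Fredholm operators, and $T_N$ and $T_{N'}$ are quasi-nilpotent operators. Then $\mathrm{ind}(T_M)=\mathrm{ind}(T_{M'})$.
   Context: $L(X)$ is the algebra of bounded linear operators on $X$. A subspace $M$ is $T$-invariant if $T(M)\subset M$, and then $T_M: M\to M$ is the restriction of $T$. $M\oplus N$ denotes the sum $M+N$ with $M\cap N=\{0\}$. For a bounded operator $S$ on a Banach space $Y$, with kernel $\mathcal N(S)$ and range $\mathcal R(S)$: $S$ is upper semi-Fredholm if $\mathcal R(S)$ is closed and $\dim\mathcal N(S)<\infty$; lower semi-Fredholm if $\mathrm{codim}\,\mathcal R(S)<\infty$; semi-Fredholm if it is upper or lower semi-Fredholm, and then $\mathrm{ind}(S)=\dim\mathcal N(S)-\mathrm{codim}\,\mathcal R(S)\in\mathbb Z\cup\{\pm\infty\}$ (infinite dimensions are all written $\infty$). $S$ is quasi-nilpotent if $0$ is the only point of its spectrum. The zero subspace is allowed; the operator on $\{0\}$ is regarded as quasi-nilpotent and as Fredholm of index $0$. *)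

(* Defs.v *)
From HB Require Import structures.
From mathcomp Require Import all_boot all_order all_algebra.
From mathcomp Require Import boolp classical_sets reals constructive_ereal.
From mathcomp Require Import topology normedtype.
From mathcomp Require Export complex.

Set Implicit Arguments.
Unset Strict Implicit.
Unset Printing Implicit Defensive.

Import Order.TTheory GRing.Theory Num.Theory.
Import numFieldNormedType.Exports.

Local Open Scope classical_set_scope.
Local Open Scope ring_scope.

Section BoundedOperators.
Context {K : numFieldType} {Y : normedModType K}.

Definition bounded_op (S : Y -> Y) : Prop :=
  exists c : K, forall y, `|S y| <= c * `|y|.

End BoundedOperators.

Record bounded_operator (K : numFieldType) (Y : normedModType K) :=
  BoundedOperator {
    bop :> {linear Y -> Y};
    bop_bounded : bounded_op bop }.

Notation "''L' ( Y )" := (bounded_operator Y) (format "''L' ( Y )") : type_scope.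

Section Dimension.
Context {K : numFieldType} {Y : lmodType K}.
Implicit Types U W : set Y.

(* For subspaces W of U: the classes modulo W of e_0, ..., e_(n-1) form a basis
   of U / W. The size n of such a basis is unique. *)
Definition quotient_basis U W n (e : 'I_n -> Y) : Prop :=
  (forall i, U (e i)) /\
  forall y, U y -> exists! a : 'rV[K]_n, W (y - \sum_i a 0 i *: e i).

Definition has_quotient_dim U W n : Prop :=
  exists e : 'I_n -> Y, quotient_basis U W e.

Definition quotient_dim U W : \bar int :=
  if `[< exists n, has_quotient_dim U W n >]
  then (get (has_quotient_dim U W))%:Z%:E else +oo%E.

Definition dim U : \bar int := quotient_dim U [set 0].

Definition codim W : \bar int := quotient_dim setT W.

End Dimension.

Section Fredholm.
Context {K : numFieldType} {Y : normedModType K}.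
Implicit Types S : 'L(Y).

Definition ker S : set Y := [set y | S y = 0].

Definition upper_semi_fredholm S : Prop :=
  closed (range S) /\ (dim (ker S) < +oo)%E.

Definition lower_semi_fredholm S : Prop := (codim (range S) < +oo)%E.

Definition semi_fredholm S : Prop :=
  upper_semi_fredholm S \/ lower_semi_fredholm S.

(* Only meaningful for semi-Fredholm S, where oo - oo does not occur. *)
Definition ind S : \bar int := (dim (ker S) - codim (range S))%E.

Definition spectrum S : set K :=
  [set l | ~ exists G : 'L(Y),
     (forall y, G (l *: y - S y) = y) /\ (forall y, l *: G y - S (G y) = y)].

(* On the zero space the spectrum is empty, but the operator is regarded as
   quasi-nilpotent. *)
Definition quasi_nilpotent S : Prop :=
  spectrum S = [set 0] \/ (forall y : Y, y = 0).

End Fredholm.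

Record closed_subspace (K : numFieldType) (X : normedModType K) :=
  ClosedSubspace {
    csub_set :> set X;
    csub0 : csub_set 0;
    csubP : forall (a : K) x y,
      csub_set x -> csub_set y -> csub_set (a *: x + y);
    csub_closed : closed csub_set }.

Section SubspaceLmodule.
Context {K : numFieldType} {X : normedModType K} (M : closed_subspace X).

Definition csub_pred : {pred X} := fun x => x \in (M : set X).

Record csub_type := CsubType { csub_val : X; _ : csub_val \in csub_pred }.

Fact csub_submod_closed : submod_closed csub_pred.
Proof.
split=> [|a x y]; rewrite !unfold_in /= !in_setE; first exact: csub0.
exact: csubP.
Qed.

HB.instance Definition _ :=
  GRing.isSubmodClosed.Build K X csub_pred csub_submod_closed.
HB.instance Definition _ := [isSub for csub_val].
HB.instance Definition _ := [Choice of csub_type by <:].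
HB.instance Definition _ := [SubChoice_isSubLmodule of csub_type by <:].

Definition csub_norm (x : csub_type) : K := `|val x|.

Fact csub_ler_normD x y : csub_norm (x + y) <= csub_norm x + csub_norm y.
Proof. exact: ler_normD. Qed.

Fact csub_normrZ (l : K) x : csub_norm (l *: x) = `|l| * csub_norm x.
Proof. exact: normrZ. Qed.

Fact csub_normr0_eq0 x : csub_norm x = 0 -> x = 0.
Proof. by move=> /normr0_eq0 x0; apply: val_inj. Qed.

HB.instance Definition _ := Lmodule_isNormed.Build K csub_type
  csub_ler_normD csub_normrZ csub_normr0_eq0.

End SubspaceLmodule.

Section SubspaceComplete.
Context {K : numFieldType} {X : completeNormedModType K}.
Variable M : closed_subspace X.

Fact csub_complete (F : set_system (csub_type M)) :
  ProperFilter F -> cauchy F -> cvg F.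
Proof.
move=> FF /cauchy_ballP Fcauchy.
have Gcauchy : cauchy (@csub_val _ _ M @ F).
  apply/cauchy_ballP => e e0; have := Fcauchy e e0.
  by rewrite -!ball_normE [X in _ -> X]near_map2.
have /cvg_ex[/= l Fl] : cvg (@csub_val _ _ M @ F) by exact: cauchy_cvg.
have Ml : l \in csub_pred M.
  apply/mem_set.
  apply: (closed_cvg _ (@csub_closed _ _ M) _ _ Fl).
  by near=> x; have /set_mem := valP x.
apply/cvg_ex; exists (CsubType Ml).
apply/cvgrPdist_lt => e e0.
by move/cvgrPdist_lt : Fl => /(_ e e0).
Unshelve. all: by end_near. Qed.

HB.instance Definition _ := Uniform_isComplete.Build (csub_type M) csub_complete.
End SubspaceComplete.

Section Restriction.
Context {K : numFieldType} {X : normedModType K}.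
Variable T : 'L(X).

Definition invariant_subspace (M : set X) : Prop := T @` M `<=` M.

Variables (M : closed_subspace X) (invM : invariant_subspace M).

Fact restr_subproof (x : csub_type M) : T (val x) \in csub_pred M.
Proof.
have /set_mem Mx := valP x.
by apply/mem_set/invM; exists (val x).
Qed.

Definition restr_fun (x : csub_type M) : csub_type M :=
  CsubType (restr_subproof x).

Fact restr_linear : linear restr_fun.
Proof. by move=> a x y; apply: val_inj; rewrite /= linearP. Qed.

HB.instance Definition _ :=
  GRing.isLinear.Build K (csub_type M) (csub_type M) _ restr_fun restr_linear.

Fact restr_bounded : bounded_op restr_fun.
Proof. by have [c Tc] := bop_bounded T; exists c => x; apply: Tc. Qed.

Definition restr : 'L(csub_type M) :=
  @BoundedOperator _ _ restr_fun restr_bounded.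

End Restriction.

Arguments restr {K X} T {M} invM.

Definition sum_set (V : zmodType) (A B : set V) : set V :=
  [set x + y | x in A & y in B].

Definition infinite_dimensional (K : numFieldType) (X : lmodType K) : Prop :=
  dim [set: X] = +oo%E.

(* Main.v *)
From HB Require Import structures.
From mathcomp Require Import all_boot all_order all_algebra.
From mathcomp Require Import boolp classical_sets reals constructive_ereal.
From mathcomp Require Import topology normedtype complex.
From mathcomp Require Import zify ring lra.
Require Import Defs.

Set Implicit Arguments.
Unset Strict Implicit.
Unset Printing Implicit Defensive.

Import Order.TTheory GRing.Theory Num.Theory.
Import numFieldNormedType.Exports.
Local Open Scope classical_set_scope.
Local Open Scope ring_scope.

(** Write Z for the common sum of M and N and of M' and N'. For l <> 0 the
operator T - l is bijective on N, because T is quasi-nilpotent there. Hence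
T - l has the same kernel on Z as on M, and the quotient of Z by (T - l) Z is
isomorphic to the quotient of M by (T - l) M: the index of T_M - l can be
computed from T and Z alone ([alg_index_restr]). The same holds for M' and N',
so T_M - l and T_M' - l have the same index for every l <> 0. It remains to let
l tend to 0, and for this the index has to be stable near 0 in the following
sense, for each integer j:
- if j <= ind A, then j <= ind (A - l) for all small l ([index_shift_lower]);
- if A is semi-Fredholm and ind A <= j, then ind (A - l) <= j for all small l
  ([index_shift_upper]).
The range of admissible l may depend on j, which is what makes the infinite
indices accessible to elementary estimates. If ind T_M < ind T_M', an integer j
with ind T_M <= j < j + 1 <= ind T_M' and one small l <> 0 give a
contradiction ([index_le]).

Stability is reduced to stability of kernels by bordering. Given vectors
f_1, ..., f_p, the operator D (y, a) = A y + sum_i a_i f_i satisfies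
ind A <= dim (ker D) - p, with equality when D is onto ([alg_index_le],
[alg_index_eq]). Replacing A by A - l replaces D by D - l P, where
P (y, a) = y.
- Lower bound: take f a basis of a complement of the range of A, so that D is
  onto. By the open mapping theorem D v = z has a solution with
  |v| <= C |z|. By successive approximation D - l P is still onto, with a
  similar constant, so each vector of ker D can be corrected by a small vector
  to lie in ker (D - l P), and finitely many independent vectors stay
  independent ([perturbed_ker_ge]).
- Upper bound: take f independent modulo the range of A, so that
  dim (ker D) = dim (ker A), and with closed range. By the open mapping theorem
  again, every u in ker (D - l P) is within C |l| |u| of ker D. Riesz's lemma
  shows that a space that is close enough to a space of finite dimension cannot
  have a larger dimension ([not_free_gap], [perturbed_ker_le]). *)

(** * Dimensions of quotients *)
Section FreeModulo.
Context {K : numFieldType}.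

Definition subspace (V : lmodType K) (U : set V) : Prop :=
  U 0 /\ forall (a : K) x y, U x -> U y -> U (a *: x + y).

Definition free_mod (V : lmodType K) (W : set V) n (e : 'I_n -> V) : Prop :=
  forall a : 'I_n -> K, W (\sum_i a i *: e i) -> forall i, a i = 0.

(** For subspaces this says that U / W has dimension at least n. These lower
bounds, for all n, also describe infinite dimensions, and a linear relation
transports them in one direction. *)
Definition has_free (V : lmodType K) (U W : set V) n : Prop :=
  exists e : 'I_n -> V, (forall i, U (e i)) /\ free_mod W e.

Definition fcons T n (x : T) (e : 'I_n -> T) (i : 'I_n.+1) : T :=
  if unlift ord0 i is Some j then e j else x.

Definition fcat T m n (e : 'I_m -> T) (f : 'I_n -> T) (i : 'I_(m + n)) : T :=
  match split i with inl j => e j | inr k => f k end.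

Lemma fcons0 T n (x : T) (e : 'I_n -> T) : fcons x e ord0 = x.
Proof. by rewrite /fcons unlift_none. Qed.

Lemma fconsS T n (x : T) (e : 'I_n -> T) i : fcons x e (lift ord0 i) = e i.
Proof. by rewrite /fcons liftK. Qed.

Lemma fcat_lshift T m n (e : 'I_m -> T) (f : 'I_n -> T) i :
  fcat e f (lshift n i) = e i.
Proof.
by rewrite /fcat -[lshift n i]/(unsplit (inl i)) unsplitK.
Qed.

Lemma fcat_rshift T m n (e : 'I_m -> T) (f : 'I_n -> T) i :
  fcat e f (rshift m i) = f i.
Proof.
by rewrite /fcat -[rshift m i]/(unsplit (inr i)) unsplitK.
Qed.

Section Subspace.
Context {V : lmodType K} {U : set V}.
Hypothesis sU : subspace U.

Lemma subspaceZ a x : U x -> U (a *: x).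
Proof. by move=> Ux; rewrite -[_ *: _]addr0; apply: sU.2 => //; apply: sU.1. Qed.

Lemma subspaceD x y : U x -> U y -> U (x + y).
Proof. by move=> Ux Uy; rewrite -[x]scale1r; apply: sU.2. Qed.

Lemma subspaceN x : U x -> U (- x).
Proof. by move=> Ux; rewrite -scaleN1r; apply: subspaceZ. Qed.

Lemma subspaceB x y : U x -> U y -> U (x - y).
Proof. by move=> Ux Uy; apply: subspaceD => //; apply: subspaceN. Qed.

Lemma subspace_sum n (a : 'I_n -> K) (e : 'I_n -> V) :
  (forall i, U (e i)) -> U (\sum_i a i *: e i).
Proof.
move=> Ue; elim/big_rec: _ => [|i x _ Ux]; first exact: sU.1.
exact: sU.2.
Qed.

End Subspace.

Lemma subspace0 (V : lmodType K) : subspace [set (0 : V)].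
Proof. by split=> // a x y -> ->; rewrite /= scaler0 addr0. Qed.

Lemma subspaceT (V : lmodType K) : subspace [set: V].
Proof. by []. Qed.

Lemma subspace_ker (V W : lmodType K) (L : {linear V -> W}) :
  subspace [set v | L v = 0].
Proof.
split=> [|a x y /= Lx Ly]; first exact: linear0.
by rewrite linearP Lx Ly scaler0 addr0.
Qed.

Lemma subspace_range (V W : lmodType K) (L : {linear V -> W}) :
  subspace (range L).
Proof.
split; first by exists 0; rewrite ?linear0.
by move=> a _ _ [x _ <-] [y _ <-]; exists (a *: x + y); rewrite ?linearP.
Qed.

Section Families.
Context {V : lmodType K}.
Implicit Types U W A B C : set V.

Lemma has_free0 U W : has_free U W 0.
Proof. by exists (fun=> 0); split=> [[]|? ? []]. Qed.

Lemma has_freeS U W n : has_free U W n.+1 -> has_free U W n.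
Proof.
move=> [e [Ue fe]]; exists (e \o lift ord0); split=> [i|a Wa i]; first exact: Ue.
have := fe (fcons 0 a); rewrite big_ord_recl fcons0 scale0r add0r.
under eq_bigr => j _ do rewrite fconsS.
by move=> /(_ Wa (lift ord0 i)); rewrite fconsS.
Qed.

Lemma has_free_le U W m n : (m <= n)%N -> has_free U W n -> has_free U W m.
Proof.
elim: n => [|n IH]; first by rewrite leqn0 => /eqP->.
by rewrite leq_eqVlt => /predU1P[->|] // /IH h /has_freeS.
Qed.

Lemma basis_free U W n (e : 'I_n -> V) :
  subspace U -> subspace W -> quotient_basis U W e -> free_mod W e.
Proof.
move=> sU sW [Ue bas] a Wa i.
have [b [_ ub]] := bas _ (subspace_sum sU a Ue).
have ba : b = \row_i a i.
  by apply: ub; under [X in _ - X]eq_bigr => j _ do rewrite mxE;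
    rewrite subrr; apply: sW.1.
have b0 : b = 0.
  apply: ub; rewrite [X in _ - X]big1 ?subr0 // => j _.
  by rewrite mxE scale0r.
by move/rowP: (etrans (esym ba) b0) => /(_ i); rewrite !mxE.
Qed.

(** If n + 1 vectors of U are combinations of e modulo W, the (n + 1) x n
matrix of coefficients has a nonzero left kernel, which is a relation between
these vectors. *)
Lemma span_not_free U W n (e : 'I_n -> V) : subspace W ->
  (forall y, U y -> exists a : 'I_n -> K, W (y - \sum_i a i *: e i)) ->
  ~ has_free U W n.+1.
Proof.
move=> sW span [f [Uf ff]].
have [c Wc] := choice (fun j => span _ (Uf j)).
pose A : 'M[K]_(n.+1, n) := \matrix_(j, i) c j i.
have kn0 : kermx A != 0.
  by rewrite kermx_eq0 /row_free neq_ltn ltnS rank_leq_col.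
(* b *m A = 0 makes b a relation modulo W between the vectors f. *)
pose b := nz_row (kermx A).
have bA : b *m A = 0 by apply/sub_kermxP; apply: nz_row_sub.
have b0 : b != 0 by rewrite nz_row_eq0.
case/negP: b0; apply/eqP/rowP => j; rewrite mxE.
apply: (ff (fun j => b 0 j)).
have -> : \sum_i b 0 i *: f i = \sum_i b 0 i *: (f i - \sum_k c i k *: e k).
  under [RHS]eq_bigr => i _ do rewrite scalerBr.
  rewrite big_split /= sumrN.
  suff -> : \sum_i b 0 i *: (\sum_k c i k *: e k) = 0 by rewrite subr0.
  under eq_bigr => i _ do rewrite scaler_sumr.
  rewrite exchange_big big1 //= => k _.
  under eq_bigr => i _ do rewrite scalerA.
  rewrite -scaler_suml.
  move/rowP: bA => /(_ k); rewrite !mxE.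
  by under eq_bigr => i _ do rewrite mxE; move=> ->; rewrite scale0r.
exact: subspace_sum.
Qed.

Lemma basis_not_free U W n (e : 'I_n -> V) :
  subspace W -> quotient_basis U W e -> ~ has_free U W n.+1.
Proof.
move=> sW [_ bas]; apply: (span_not_free (e := e)) => // y /bas[a [Wa _]].
by exists (fun i => a 0 i).
Qed.

(** A vector y of U added to a maximal free family gives a relation, in which
the coefficient of y cannot vanish, so y can be solved for. *)
Lemma maximal_free_basis U W n (e : 'I_n -> V) :
  subspace U -> subspace W -> (forall i, U (e i)) -> free_mod W e ->
  ~ has_free U W n.+1 -> quotient_basis U W e.
Proof.
move=> sU sW Ue fe nS; split=> // y Uy.
have : ~ free_mod W (fcons y e).
  move=> fy; apply: nS; exists (fcons y e); split=> // i.
  by rewrite /fcons; case: unliftP.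
move=> /existsNP[a /not_implyP[]].
rewrite big_ord_recl fcons0; under eq_bigr => i _ do rewrite fconsS.
move=> Wa /existsNP[i0 ai0].
have a0 : a ord0 != 0.
  apply/negP => /eqP a00; move: Wa; rewrite a00 scale0r add0r => /fe a'0.
  by apply: ai0; case: (unliftP ord0 i0) => [j ->|->].
exists (\row_i (- (a ord0)^-1 * a (lift ord0 i))); split.
  have -> : y - \sum_i (\row_i (- (a ord0)^-1 * a (lift ord0 i))) 0 i *: e i
     = (a ord0)^-1 *: (a ord0 *: y + \sum_i a (lift ord0 i) *: e i).
    rewrite scalerDr scalerA mulVf // scale1r scaler_sumr -sumrN; congr (_ + _).
    by apply: eq_bigr => i _; rewrite mxE scalerA mulNr scaleNr opprK.
  exact: subspaceZ.
move=> b Wb; apply/rowP => i; rewrite !mxE.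
have := fe (fun i => - (a ord0)^-1 * a (lift ord0 i) - b 0 i).
move=> /(_ _ i)/eqP; rewrite subr_eq0 => h; apply/eqP/h.
have -> : \sum_i (- (a ord0)^-1 * a (lift ord0 i) - b 0 i) *: e i =
  (y - \sum_i b 0 i *: e i) -
  (a ord0)^-1 *: (a ord0 *: y + \sum_i a (lift ord0 i) *: e i).
  rewrite scalerDr scalerA mulVf // scale1r scaler_sumr opprD addrACA.
  rewrite [y - y + _]addrC -addrA subrr addr0 -!sumrN -big_split.
  apply: eq_bigr => k _.
  by rewrite scalerDl mulNr !scaleNr scalerA addrC.
by apply: (subspaceB sW) => //; apply: subspaceZ.
Qed.

Lemma basis_has_free U W n (e : 'I_n -> V) m :
  subspace U -> subspace W -> quotient_basis U W e ->
  has_free U W m <-> (m <= n)%N.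
Proof.
move=> sU sW be; split=> [fm|mn].
  rewrite leqNgt; apply/negP => nm; apply: (basis_not_free sW be).
  exact: has_free_le fm.
by apply: (has_free_le mn); exists e; split; [case: be|apply: basis_free be].
Qed.

Lemma has_quotient_dimE U W n : subspace U -> subspace W ->
  has_quotient_dim U W n <-> has_free U W n /\ ~ has_free U W n.+1.
Proof.
move=> sU sW; split=> [[e be]|[[e [Ue fe]] nS]].
  by rewrite !(basis_has_free _ sU sW be) ltnn.
by exists e; apply: maximal_free_basis.
Qed.

(** Dimensions enter only through this case analysis: [quotient_dim] is the
size of a basis, or +oo when there are free families of every size. *)
Variant quotient_dim_spec U W : \bar int -> Prop :=
| QuotientDimFin n (e : 'I_n -> V) of quotient_basis U W e :
    quotient_dim_spec U W (n%:Z)%:E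
| QuotientDimInf of (forall n, has_free U W n) :
    quotient_dim_spec U W +oo%E.

Lemma quotient_dimP U W : subspace U -> subspace W ->
  quotient_dim_spec U W (quotient_dim U W).
Proof.
move=> sU sW; rewrite /quotient_dim; case: asboolP => [ex|nex].
  by have [e be] := getPex ex; apply: QuotientDimFin be.
apply: QuotientDimInf; elim=> [|n IH]; first exact: has_free0.
apply: contrapT => nS; apply: nex; exists n.
exact/has_quotient_dimE.
Qed.

Lemma le_quotient_dim U W n : subspace U -> subspace W ->
  ((n%:Z)%:E <= quotient_dim U W)%E <-> has_free U W n.
Proof.
move=> sU sW; case: (quotient_dimP sU sW) => [m e be|inf]; last by rewrite leey.
by rewrite lee_fin (basis_has_free _ sU sW be).
Qed.

Lemma quotient_dim_ge0 U W : subspace U -> subspace W ->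
  (0 <= quotient_dim U W)%E.
Proof. by move=> sU sW; case: (quotient_dimP sU sW) => // *; rewrite lee_fin. Qed.

Lemma quotient_dim_basis U W n (e : 'I_n -> V) :
  subspace U -> subspace W -> quotient_basis U W e ->
  quotient_dim U W = (n%:Z)%:E.
Proof.
move=> sU sW be; case: (quotient_dimP sU sW) => [m f bf|inf].
  have /(basis_has_free _ sU sW bf) mn : has_free U W n.
    exact/(basis_has_free _ sU sW be).
  have /(basis_has_free _ sU sW be) nm : has_free U W m.
    exact/(basis_has_free _ sU sW bf).
  by congr (_%:Z%:E); apply/eqP; rewrite eqn_leq nm mn.
by have /(basis_has_free _ sU sW be) := inf n.+1; rewrite ltnn.
Qed.

Lemma free_cat A B C m n : subspace A -> subspace B ->
  A `<=` B -> B `<=` C ->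
  has_free C B m -> has_free B A n -> has_free C A (m + n)%N.
Proof.
move=> sA sB AB BC [e [Ce fe]] [f [Bf ff]].
exists (fcat e f); split=> [i|a].
  by rewrite /fcat; case: split => // j; apply/BC/Bf.
rewrite big_split_ord /=.
under eq_bigr => i _ do rewrite fcat_lshift.
under [X in _ + X]eq_bigr => i _ do rewrite fcat_rshift.
move=> Aa.
have a1 i : a (lshift n i) = 0.
  apply: (fe (a \o lshift n)) => /=.
  rewrite -[\sum_i _](addrK (\sum_i a (rshift m i) *: f i)).
  by apply: (subspaceB sB); [apply: AB|apply: subspace_sum].
have a2 i : a (rshift m i) = 0.
  apply: (ff (fun j => a (rshift m j))).
  move: Aa; under eq_bigr => j _ do rewrite a1 scale0r.
  by rewrite big1 // add0r.
by move=> i; case: (split_ordP i) => j ->.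
Qed.

(** A basis of C / B followed by a basis of B / A is a basis of C / A; when one
of the dimensions is infinite, so is the sum, by [free_cat]. *)
Lemma quotient_dimD A B C : subspace A -> subspace B -> subspace C ->
  A `<=` B -> B `<=` C ->
  quotient_dim C A = (quotient_dim C B + quotient_dim B A)%E.
Proof.
move=> sA sB sC AB BC.
have inf : (forall n, has_free C A n) -> quotient_dim C A = +oo%E.
  case: (quotient_dimP sC sA) => // n e be /(_ n.+1).
  by rewrite (basis_has_free _ sC sA be) ltnn.
case: (quotient_dimP sC sB) => [m e be|hm]; last first.
  rewrite inf => [|n].
    by have := quotient_dim_ge0 sB sA; case: quotient_dim.
  by rewrite -[n]addn0; apply: free_cat (hm n) (has_free0 B A).
case: (quotient_dimP sB sA) => [n f bf|hn]; last first.
  rewrite inf // => n; rewrite -[n]add0n.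
  by apply: free_cat (has_free0 C B) (hn n).
rewrite -EFinD -PoszD; apply: (@quotient_dim_basis _ _ _ (fcat e f)) => //.
have ff := basis_free sB sA bf; have fe := basis_free sC sB be.
case: bf be => [Bf bf] [Ce be].
split=> [i|y Cy].
  by rewrite /fcat; case: split => // j; apply/BC/Bf.
have [a [Ba ua]] := be y Cy; have [b [Ab ub]] := bf _ Ba.
have Ecat (c : 'rV_(m + n)) : \sum_i c 0 i *: fcat e f i =
    \sum_i (lsubmx c) 0 i *: e i + \sum_i (rsubmx c) 0 i *: f i.
  rewrite big_split_ord; congr (_ + _); apply: eq_bigr => i _ /=.
    by rewrite fcat_lshift mxE.
  by rewrite fcat_rshift mxE.
exists (row_mx a b); split.
  by rewrite Ecat row_mxKl row_mxKr opprD addrA.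
move=> c Ac; rewrite -[c]hsubmxK.
rewrite Ecat opprD addrA in Ac.
have ca : a = lsubmx c.
  apply: ua; rewrite -[X in B X](subrK (\sum_i (rsubmx c) 0 i *: f i)).
  by apply: (subspaceD sB); [apply: AB|apply: subspace_sum].
by congr row_mx => //; apply: ub; rewrite ca.
Qed.

End Families.

(** A linear relation, instead of a linear map, lets a vector be sent to
something determined only up to the subspace one works modulo, or by a
projection that is only defined on a sum of subspaces. *)
Lemma has_free_transfer (V V' : lmodType K) (U W : set V) (U' W' : set V')
    (Rel : V -> V' -> Prop) n :
  subspace U -> Rel 0 0 ->
  (forall a x x' y y', Rel x x' -> Rel y y' -> Rel (a *: x + y) (a *: x' + y')) ->
  (forall x, U x -> exists2 x', U' x' & Rel x x') ->
  (forall x x', U x -> Rel x x' -> W' x' -> W x) ->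
  has_free U W n -> has_free U' W' n.
Proof.
move=> sU R0 RD tot RW [e [Ue fe]].
have {}tot i : exists x', U' x' /\ Rel (e i) x'.
  by have [x' U'x' Rx] := tot _ (Ue i); exists x'.
have [e' He'] := choice tot.
exists e'; split=> [i|a W'a]; first by case: (He' i).
apply: fe; apply: (RW _ (\sum_i a i *: e' i)) => //; first exact: subspace_sum.
elim/big_rec2: _ => [//|i y y' _ Ry].
by apply: RD => //; case: (He' i).
Qed.

Lemma quotient_dim_transfer (V V' : lmodType K) (U W : set V) (U' W' : set V')
    (Rel : V -> V' -> Prop) :
  subspace U -> subspace W -> subspace U' -> subspace W' -> Rel 0 0 ->
  (forall a x x' y y', Rel x x' -> Rel y y' -> Rel (a *: x + y) (a *: x' + y')) ->
  (forall x, U x -> exists2 x', U' x' & Rel x x') ->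
  (forall x x', U x -> Rel x x' -> W' x' -> W x) ->
  (quotient_dim U W <= quotient_dim U' W')%E.
Proof.
move=> sU sW sU' sW' R0 RD tot RW.
case: (quotient_dimP sU sW) => [n e be|inf].
  apply/le_quotient_dim => //; apply: has_free_transfer R0 RD tot RW _ => //.
  exact/(basis_has_free _ sU sW be).
case: (quotient_dimP sU' sW') => // n e be.
have := has_free_transfer sU R0 RD tot RW (inf n.+1).
by rewrite (basis_has_free _ sU' sW' be) ltnn.
Qed.

Lemma dim_rV p : dim [set: 'rV[K]_p] = (p%:Z)%:E.
Proof.
apply: (@quotient_dim_basis _ _ _ _ (fun i => delta_mx 0 i)) => //.
  exact: subspace0.
split=> // y _; exists y; split; first by rewrite -row_sum_delta subrr.
by move=> a /= /eqP; rewrite -row_sum_delta subr_eq0 => /eqP.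
Qed.

End FreeModulo.

(** * Real-valued norms over the complex numbers *)
Section RealNorms.
Context {R : realType}.

(** The norm of a normed space over R[i] takes its values in R[i]. Its real
part carries the same information and lives in an ordered field where
linear arithmetic applies. *)
Definition nrm (X : normedZmodType R[i]) (x : X) : R := complex.Re `|x|.

Lemma nrmE (X : normedZmodType R[i]) (x : X) : `|x| = real_complex R (nrm x).
Proof. by rewrite RRe_real ?normr_real. Qed.

Definition cabs (a : R[i]) : R := nrm a.

Lemma cabsM a b : cabs (a * b) = cabs a * cabs b.
Proof.
by apply: (@complexI R); rewrite rmorphM /= -!nrmE normrM.
Qed.

Lemma cabsD a b : cabs (a + b) <= cabs a + cabs b.
Proof. by rewrite -lecR rmorphD /= -!nrmE ler_normD. Qed.

Lemma cabs_ge0 a : 0 <= cabs a.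
Proof. by rewrite -ler0c -nrmE. Qed.

Lemma cabs_eq0 a : cabs a = 0 -> a = 0.
Proof. by move=> h; apply/eqP; rewrite -normr_eq0 nrmE -/(cabs a) h. Qed.

Lemma cabs_gt0 a : a != 0 -> 0 < cabs a.
Proof.
by move=> a0; rewrite lt0r cabs_ge0 andbT; apply: contra_neq a0; apply: cabs_eq0.
Qed.

Lemma cabs0 : cabs 0 = 0.
Proof. by apply: (@complexI R); rewrite -nrmE normr0. Qed.

Lemma cabsV a : cabs a^-1 = (cabs a)^-1.
Proof. by apply: (@complexI R); rewrite fmorphV /= -!nrmE normfV. Qed.

Lemma cabs_real (r : R) : 0 <= r -> cabs (real_complex R r) = r.
Proof. by move=> r0; apply: (@complexI R); rewrite -nrmE ger0_norm ?ler0c. Qed.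

Lemma cabs_Re_Im a : cabs a <= `|complex.Re a| + `|complex.Im a|.
Proof.
rewrite -lecR -nrmE normc_def lecR.
rewrite -(@ler_pXn2r _ 2) ?nnegrE ?sqrtr_ge0 ?addr_ge0 // sqr_sqrtr ?addr_ge0 ?sqr_ge0 //.
rewrite -[complex.Re a ^+ 2]real_normK ?num_real // -[complex.Im a ^+ 2]real_normK ?num_real //.
rewrite sqrrD lerD2r lerDl mulrn_wge0 // mulr_ge0 //.
Qed.

Lemma Re_le_cabs a : `|complex.Re a| <= cabs a.
Proof. by rewrite -lecR -nrmE; apply: normc_ge_Re. Qed.

Lemma Im_le_cabs a : `|complex.Im a| <= cabs a.
Proof.
rewrite -lecR -nrmE normc_def lecR -sqrtr_sqr ler_sqrt ?addr_ge0 ?sqr_ge0 //.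
by rewrite lerDr sqr_ge0.
Qed.

Record is_norm (V : lmodType R[i]) (n : V -> R) : Prop := IsNorm {
  norm_eq0 : forall x, n x = 0 -> x = 0;
  norm_triangle : forall x y, n (x + y) <= n x + n y;
  normZ : forall a x, n (a *: x) = cabs a * n x }.

(** Closedness and completeness in terms of a norm only, so that they apply to
product spaces without endowing them with a topology. *)
Definition norm_closed (V : lmodType R[i]) (n : V -> R) (F : set V) : Prop :=
  forall x, (forall e, 0 < e -> exists2 y, F y & n (x - y) <= e) -> F x.

(** Sequences with steps at most 2^-k suffice for completeness, and this form
comes with an explicit rate, which passes to products componentwise. *)
Definition fast_complete (V : lmodType R[i]) (n : V -> R) : Prop :=
  forall u : nat -> V, (forall k, n (u k.+1 - u k) <= 2^-1 ^+ k) ->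
  exists l, forall k, n (l - u k) <= 2 * 2^-1 ^+ k.

Lemma half_ge0 k : 0 <= (2^-1 : R) ^+ k.
Proof. by rewrite exprn_ge0 // invr_ge0. Qed.

Lemma half_gt0 k : 0 < (2^-1 : R) ^+ k.
Proof. by rewrite exprn_gt0 // invr_gt0. Qed.

Lemma half_small (c e : R) : 0 < e -> exists k, c * 2^-1 ^+ k <= e.
Proof.
move=> e0; have [c0|c0] := leP c 0.
  by exists 0%N; rewrite expr0 mulr1 (le_trans c0) ?ltW.
have := archi_boundP (ltW (divr_gt0 c0 e0)).
set k := Num.bound _ => ck; exists k.
rewrite exprVn ler_pdivrMr ?exprn_gt0 // mulrC -ler_pdivrMr //.
rewrite (le_trans (ltW ck)) // -natrX ler_nat ltnW //.
exact: ltn_expl.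
Qed.

Lemma le_half_eps (x y c : R) : (forall k, x <= y + c * 2^-1 ^+ k) -> x <= y.
Proof.
move=> h; apply/ler_addgt0Pr => e e0; have [k ck] := half_small c e0.
by rewrite (le_trans (h k)) // lerD2l.
Qed.

Lemma halfS k : (2^-1 : R) ^+ k.+1 = 2^-1 * 2^-1 ^+ k.
Proof. exact: exprS. Qed.

Section NormTheory.
Context {V : lmodType R[i]} {n : V -> R}.
Hypothesis nV : is_norm n.

Lemma norm0 : n 0 = 0.
Proof. by rewrite -(scale0r 0) (normZ nV) cabs0 mul0r. Qed.

Lemma normN x : n (- x) = n x.
Proof.
rewrite -scaleN1r (normZ nV).
suff -> : cabs (-1) = 1 by rewrite mul1r.
by apply: (@complexI R); rewrite -nrmE normrN1.
Qed.

Lemma normB x y : n (x - y) = n (y - x).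
Proof. by rewrite -normN opprB. Qed.

Lemma norm_ge0 x : 0 <= n x.
Proof.
have := norm_triangle nV x (- x); rewrite subrr norm0 normN; lra.
Qed.

Lemma norm_triB x y z : n (x - z) <= n (x - y) + n (y - z).
Proof. by rewrite (le_trans _ (norm_triangle nV _ _)) // addrA subrK. Qed.

Lemma norm_gt0 x : x != 0 -> 0 < n x.
Proof.
by move=> x0; rewrite lt0r norm_ge0 andbT; apply: contra_neq x0; apply: norm_eq0.
Qed.

Lemma norm_sum p (a : 'I_p -> R[i]) (f : 'I_p -> V) c :
  (forall i, n (f i) <= c) ->
  n (\sum_i a i *: f i) <= (\sum_i cabs (a i)) * c.
Proof.
move=> fc; rewrite mulr_suml.
elim/big_rec2: _ => [|i x y _ xy]; first by rewrite norm0.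
rewrite (le_trans (norm_triangle nV _ _)) // lerD // (normZ nV).
by rewrite ler_wpM2l ?cabs_ge0.
Qed.

Lemma fast_tail (u : nat -> V) c :
  (forall k, n (u k.+1 - u k) <= c * 2^-1 ^+ k) ->
  forall m k, n (u (k + m)%N - u k) <= c * (2 * (2^-1 ^+ k - 2^-1 ^+ (k + m)%N)).
Proof.
move=> uc; elim=> [|m IH] k.
  by rewrite addn0 !subrr norm0 !mulr0.
rewrite (le_trans (norm_triB _ (u (k + m)%N) _)) //.
have := uc (k + m)%N; have := IH k; rewrite addnS halfS.
move: (2^-1 ^+ (k + m)) (2^-1 ^+ k) => x y; lra.
Qed.

Lemma fast_tail_le (u : nat -> V) :
  (forall k, n (u k.+1 - u k) <= 2^-1 ^+ k) ->
  forall m k, n (u (k + m)%N - u k) <= 2 * 2^-1 ^+ k.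
Proof.
move=> hu m k; rewrite (le_trans (@fast_tail u 1 _ m k)) //.
  by move=> j; rewrite mul1r.
by rewrite mul1r ler_pM2l // gerBl half_ge0.
Qed.

Lemma fast_complete_scale : fast_complete n ->
  forall (u : nat -> V) c, 0 <= c ->
  (forall k, n (u k.+1 - u k) <= c * 2^-1 ^+ k) ->
  exists l, forall k, n (l - u k) <= 2 * c * 2^-1 ^+ k.
Proof.
move=> comp u c; rewrite le0r => /predU1P[->|c0] uc.
  exists (u 0%N) => k; have := fast_tail uc k 0; rewrite !mul0r add0n normB.
  by rewrite mulr0 mul0r.
pose C := real_complex R c.
have C0 : C != 0 by rewrite fmorph_eq0 gt_eqF.
have aC : cabs C = c by rewrite cabs_real ?ltW.
have [|l hl] := comp (fun k => C^-1 *: u k).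
  move=> k; rewrite -scalerBr (normZ nV) cabsV aC.
  by rewrite ler_pdivrMl.
exists (C *: l) => k.
have -> : C *: l - u k = C *: (l - C^-1 *: u k).
  by rewrite scalerBr scalerA divff // scale1r.
by rewrite (normZ nV) aC -mulrA mulrCA ler_pM2l.
Qed.

End NormTheory.

(** The sequences u_k - 2 * 2^-k and u_k + 2 * 2^-k are monotone and enclose the
limit, which is the supremum of the first one. *)
Lemma real_fast_complete (u : nat -> R) :
  (forall k, `|u k.+1 - u k| <= 2^-1 ^+ k) ->
  exists l, forall k, `|l - u k| <= 2 * 2^-1 ^+ k.
Proof.
move=> hu.
have incr m k : u k - 2 * 2^-1 ^+ k <= u (k + m)%N - 2 * 2^-1 ^+ (k + m)%N.
  elim: m => [|m IH]; first by rewrite addn0.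
  apply: (le_trans IH); have := hu (k + m)%N; rewrite addnS halfS ler_norml.
  move: (2^-1 ^+ _) => x; lra.
have decr m k : u (k + m)%N + 2 * 2^-1 ^+ (k + m)%N <= u k + 2 * 2^-1 ^+ k.
  elim: m => [|m IH]; first by rewrite addn0.
  apply: le_trans IH; have := hu (k + m)%N; rewrite addnS halfS ler_norml.
  move: (2^-1 ^+ _) => x; lra.
have bnd j k : u k - 2 * 2^-1 ^+ k <= u j + 2 * 2^-1 ^+ j.
  have h1 := incr j k; have h2 := decr k j.
  have := half_ge0 (k + j); move: h1 h2; rewrite [(j + k)%N]addnC.
  move: (2^-1 ^+ (k + j)%N) => x; lra.
pose S := range (fun k => u k - 2 * 2^-1 ^+ k).
have S0 : S !=set0 by exists (u 0%N - 2 * 2^-1 ^+ 0); exists 0%N.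
exists (sup S) => k.
have h1 : u k - 2 * 2^-1 ^+ k <= sup S.
  apply: sup_upper_bound; last by exists k.
  by split=> //; exists (u 0%N + 2 * 2^-1 ^+ 0) => _ [j _ <-].
have h2 : sup S <= u k + 2 * 2^-1 ^+ k.
  by apply: ge_sup => // _ [j _ <-].
rewrite ler_norml; lra.
Qed.

Lemma complex_norm : is_norm (cabs : R[i]^o -> R).
Proof. by split; [exact: cabs_eq0|exact: cabsD|exact: cabsM]. Qed.

Lemma complex_complete (u : nat -> R[i]) c : 0 <= c ->
  (forall k, cabs (u k.+1 - u k) <= c * 2^-1 ^+ k) ->
  exists l, forall k, cabs (l - u k) <= 4 * c * 2^-1 ^+ k.
Proof.
move=> c0 hu.
suff H (v : nat -> R[i]^o) : (forall k, cabs (v k.+1 - v k) <= 2^-1 ^+ k) ->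
    exists l, forall k, cabs (l - v k) <= 4 * 2^-1 ^+ k.
  move: c0; rewrite le0r => /predU1P[c0|c0].
    exists (u 0%N) => k; rewrite c0 in hu *.
    have := fast_tail complex_norm hu k 0; rewrite !mul0r add0n.
    by rewrite (normB complex_norm) mulr0 mul0r.
  pose C := real_complex R c.
  have C0 : C != 0 by rewrite fmorph_eq0 gt_eqF.
  have aC : cabs C = c by rewrite cabs_real ?ltW.
  have [|l hl] := H (fun k => C^-1 * u k).
    by move=> k; rewrite -mulrBr cabsM cabsV aC ler_pdivrMl.
  exists (C * l) => k.
  have -> : C * l - u k = C * (l - C^-1 * u k).
    by rewrite mulrBr mulrA divff // mul1r.
  by rewrite cabsM aC -mulrA mulrCA ler_pM2l.
move=> hv.
have [|x hx] := @real_fast_complete (fun k => complex.Re (v k)).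
  move=> k; rewrite (le_trans _ (hv k)) // (le_trans _ (Re_le_cabs _)) //.
  by case: (v k.+1) => ? ?; case: (v k).
have [|y hy] := @real_fast_complete (fun k => complex.Im (v k)).
  move=> k; rewrite (le_trans _ (hv k)) // (le_trans _ (Im_le_cabs _)) //.
  by case: (v k.+1) => ? ?; case: (v k).
exists (Complex x y) => k; rewrite (le_trans (cabs_Re_Im _)) //.
have := hx k; have := hy k; case: (v k) => a b /=; lra.
Qed.

(** * The open mapping theorem *)
Section Operators.
Context {V W : lmodType R[i]} {n : V -> R} {p : W -> R}.
Hypotheses (nV : is_norm n) (nW : is_norm p).
Implicit Types D : {linear V -> W}.

(** Successive approximation: solving D v = z up to an error of half the size
of z, then for the error, and so on, gives a geometric series that converges to
a solution. It serves both the open mapping theorem and the perturbation of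
surjective operators. *)
Lemma solvable_of_approx D (F : set W) B C :
  fast_complete n -> (forall v, p (D v) <= B * n v) -> 0 <= B -> 0 <= C ->
  (forall z, F z -> exists v,
     [/\ n v <= C * p z, F (z - D v) & p (z - D v) <= p z / 2]) ->
  forall z, F z -> exists2 v, D v = z & n v <= 2 * C * p z.
Proof.
move=> comp DB B0 C0 approx z0 Fz0.
have {}approx z : exists v, F z ->
    [/\ n v <= C * p z, F (z - D v) & p (z - D v) <= p z / 2].
  by have [/approx[v]|] := pselect (F z); [exists v|exists 0].
have [s hs] := choice approx.
pose u := fix u k := if k is k'.+1 then u k' + s (z0 - D (u k')) else 0.
have inv k : F (z0 - D (u k)) /\ p (z0 - D (u k)) <= p z0 * 2^-1 ^+ k.
  elim: k => [|k [Fk pk]] /=; first by rewrite linear0 subr0 expr0 mulr1.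
  have [_ Fs ps] := hs _ Fk; rewrite linearD opprD addrA; split=> //.
  rewrite (le_trans ps) // halfS; lra.
have uC k : n (u k.+1 - u k) <= C * p z0 * 2^-1 ^+ k.
  have [Fk pk] := inv k; have [h _ _] := hs _ Fk.
  by rewrite /= addrC addrA addNr add0r (le_trans h) // -mulrA ler_wpM2l.
have c0 : 0 <= C * p z0 by rewrite mulr_ge0 // norm_ge0.
have [l hl] := fast_complete_scale nV comp c0 uC.
exists l; last first.
  by have := hl 0%N; rewrite /= subr0 expr0 mulr1 mulrA.
apply/eqP; rewrite eq_sym -subr_eq0; apply/eqP/(norm_eq0 nW)/le_anti.
rewrite (norm_ge0 nW) andbT.
apply: (@le_half_eps _ _ (p z0 + B * (2 * (C * p z0)))) => k; rewrite add0r.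
rewrite (le_trans (norm_triB nW _ (D (u k)) _)) // mulrDl.
rewrite lerD ?(inv k).2 // -linearB (le_trans (DB _)) // -mulrA ler_wpM2l //.
by rewrite (normB nV) hl.
Qed.

(** Baire's argument inside the closed subspace [range D]. If, for each k, the
image of the ball of radius k were dense in no ball of the range, one could
choose nested balls of the range such that for each k one of them avoids the
image of the ball of radius k; their common point would be in the range but
would have no preimage. Hence the image of some ball is dense in a ball of the
range, so D v = z can be solved approximately, with control on v, and
[solvable_of_approx] applies. *)
Lemma open_mapping D B :
  fast_complete n -> fast_complete p ->
  (forall v, p (D v) <= B * n v) -> 0 <= B -> norm_closed p (range D) ->
  exists2 C, 0 <= C &
    forall z, range D z -> exists2 v, D v = z & n v <= C * p z.
Proof.
move=> compV compW DB B0 clD.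
pose dense_in k y r := forall y', range D y' -> p (y' - y) <= r ->
  forall e, 0 < e -> exists2 v, n v <= k & p (y' - D v) <= e.
have rD0 : range D 0 by exists 0; rewrite ?linear0.
have rDB x y : range D x -> range D y -> range D (x - y).
  by move=> [v _ <-] [w _ <-]; exists (v - w); rewrite ?linearB.
have [k [y [r [Dy r0 hk]]]] :
    exists k : nat, exists y r, [/\ range D y, 0 < r & dense_in k%:R y r].
  apply: contrapT => nex.
  (* From the ball with centre and radius yr to a smaller one that avoids the
     image of the ball of radius k. *)
  have step (k : nat) (yr : W * R) : exists yr' : W * R,
      range D yr.1 -> 0 < yr.2 -> [/\ range D yr'.1, 0 < yr'.2,
        p (yr'.1 - yr.1) <= yr.2 / 2, yr'.2 <= yr.2 / 2 &
        forall v, n v <= k%:R -> yr'.2 < p (yr'.1 - D v)].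
    case: yr => y r; have [[Dy r0]|h] := pselect (range D y /\ 0 < r); last first.
      by exists (y, r) => /= Dy r0; case: h.
    have : ~ dense_in k%:R y (r / 2).
      by move=> h; apply: nex; exists k, y, (r / 2); split=> //; lra.
    move=> /existsNP[y' /not_implyP[Dy' /not_implyP[y'y /existsNP[e]]]].
    move=> /not_implyP[e0 he]; exists (y', Num.min e (r / 2)) => /= _ _.
    split=> //; first by rewrite lt_min e0 /=; lra.
      by rewrite ge_min lexx orbT.
    move=> v vk; rewrite gt_min ltNge; apply/orP; left; apply/negP => h.
    by apply: he; exists v.
  have {}step (ky : nat * (W * R)) := step ky.1 ky.2.
  have [s0 hs0] := choice step.
  pose s k yr := s0 (k, yr); have hs k yr := hs0 (k, yr).
  pose st := fix st k := if k is k'.+1 then s k' (st k') else (0 : W, 1 : R).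
  have inv k : [/\ range D (st k).1, 0 < (st k).2 & (st k).2 <= 2^-1 ^+ k].
    elim: k => [|k [Dk rk hk]] /=; first by rewrite expr0; split.
    have [Dk' rk' _ le _] := hs k _ Dk rk; split=> //.
    rewrite (le_trans le) // halfS; lra.
  have dist k : p ((st k.+1).1 - (st k).1) <= (st k).2 / 2.
    by have [Dk rk _] := inv k; have [] := hs k _ Dk rk.
  have [|l hl] := compW (fun k => (st k).1).
    move=> k; rewrite (le_trans (dist k)) //; have [_ _] := inv k.
    by have := half_ge0 k; lra.
  have ball k m : p ((st (k + m)%N).1 - (st k).1) <= (st k).2 - (st (k + m)%N).2.
    elim: m => [|m IH]; first by rewrite addn0 !subrr (norm0 nW).
    rewrite addnS (le_trans (norm_triB nW _ (st (k + m)%N).1 _)) //.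
    have := dist (k + m)%N; have [Dk rk _] := inv (k + m)%N.
    have [_ _ _ + _] := hs (k + m)%N _ Dk rk; move: IH => /=; lra.
  have limit_in_ball k : p (l - (st k).1) <= (st k).2.
    apply: (@le_half_eps _ _ 2) => m.
    rewrite (le_trans (norm_triB nW _ (st (k + m)%N).1 _)) //.
    rewrite addrC lerD //.
      by rewrite (le_trans (ball k m)) //; have [_ + _] := inv (k + m)%N; lra.
    rewrite (le_trans (hl _)) // ler_pM2l // exprD ler_piMl ?half_ge0 //.
    by rewrite exprn_ile1 //; lra.
  have [v _ vl] : range D l.
    apply: clD => e e0; have [k hk] := half_small 2 e0.
    exists (st k).1; first by have [] := inv k.
    by rewrite (le_trans (hl k)).
  have [k vk] : exists k : nat, n v <= k%:R.
    by exists (Num.bound (n v)); rewrite ltW // archi_boundP // norm_ge0.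
  have [Dk rk _] := inv k; have [_ _ _ _ /(_ v vk)] := hs k _ Dk rk.
  by rewrite vl (normB nW) ltNge => /negP; apply; apply: (limit_in_ball k.+1).
exists (2 * (2 * k%:R / r)); first by rewrite !mulr_ge0 ?invr_ge0 // ltW.
apply: (solvable_of_approx compV DB B0); first by rewrite !mulr_ge0 ?invr_ge0 // ltW.
move=> z Dz; have [->|z0] := eqVneq z 0.
  exists 0; rewrite linear0 subr0 !norm0 // mulr0 mul0r; split=> //.
have pz := norm_gt0 nW z0.
(* Scale z to norm r; then t z = (y + t z) - y, and both terms lie in the ball
   around y where images are dense. *)
pose t := real_complex R (r / p z).
have t0 : t != 0 by rewrite fmorph_eq0 gt_eqF // divr_gt0.
have abst : cabs t = r / p z by rewrite cabs_real // ltW // divr_gt0.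
have Dt : range D (t *: z).
  by case: Dz => v _ <-; exists (t *: v); rewrite ?linearZ.
have ptz : p (t *: z) = r by rewrite (normZ nW) abst divfK // gt_eqF.
have e0 : 0 < r / 4 by lra.
have [v vk hv] : exists2 v, n v <= k%:R & p (y + t *: z - D v) <= r / 4.
  apply: hk => //; last by rewrite addrC addKr ptz.
  by rewrite -[t *: z]opprK; apply: (rDB) => //; rewrite -sub0r; apply: rDB.
have [w wk hw] : exists2 v, n v <= k%:R & p (y - D v) <= r / 4.
  by apply: hk => //; rewrite subrr (norm0 nW) ltW.
exists (t^-1 *: (v - w)).
have ht : n (v - w) <= 2 * k%:R.
  rewrite (le_trans (norm_triangle nV _ _)) // (normN nV); lra.
split.
- rewrite (normZ nV) cabsV abst invf_div.
  have -> : 2 * k%:R / r * p z = p z / r * (2 * k%:R) by ring.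
  by rewrite ler_wpM2l // divr_ge0 // ltW.
- by apply: rDB => //; exists (t^-1 *: (v - w)).
have -> : z - D (t^-1 *: (v - w)) = t^-1 *: (t *: z - D (v - w)).
  by rewrite linearZ scalerBr scalerA mulVf // scale1r.
rewrite (normZ nW) cabsV abst invf_div.
have -> : t *: z - D (v - w) = (y + t *: z - D v) - (y - D w).
  rewrite linearB !opprB addrA [t *: z + _]addrC [RHS]addrC !addrA.
  by rewrite subrK.
have le_r : p (y + t *: z - D v - (y - D w)) <= r / 2.
  rewrite (le_trans (norm_triangle nW _ _)) // (normN nW); lra.
apply: (le_trans (ler_wpM2l _ le_r)); first by rewrite divr_ge0 // ltW.
have -> : p z / r * (r / 2) = p z / 2 by field; rewrite gt_eqF.
exact: lexx.
Qed.

End Operators.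
End RealNorms.

(** * Subspaces of finite dimension *)
Section FiniteDimension.
Context {R : realType} {V : lmodType R[i]} {n : V -> R}.
Hypothesis nV : is_norm n.

Lemma dist_gt0 (F : set V) f : norm_closed n F -> ~ F f ->
  exists2 d, 0 < d & forall y, F y -> d <= n (f - y).
Proof.
move=> clF nFf; apply: contrapT => nex; apply: nFf; apply: clF => e e0.
apply: contrapT => ney; apply: nex; exists e => // y Fy.
by rewrite leNgt; apply/negP => /ltW h; apply: ney; exists y.
Qed.

(** The distance of a f to F is |a| times the positive distance of f to F. *)
Lemma line_bound (F : set V) f : subspace F -> norm_closed n F -> ~ F f ->
  exists2 E, 0 <= E & forall x a, F x -> cabs a <= E * n (x + a *: f).
Proof.
move=> sF clF nFf; have [d d0 hd] := dist_gt0 clF nFf.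
exists d^-1; first by rewrite invr_ge0 ltW.
move=> x a Fx; have [->|a0] := eqVneq a 0.
  rewrite cabs0; apply: mulr_ge0; last exact: (norm_ge0 nV).
  by rewrite invr_ge0 ltW.
rewrite mulrC ler_pdivlMr //.
have -> : x + a *: f = a *: (f - (- a^-1 *: x)).
  by rewrite scaleNr opprK scalerDr scalerA divff // scale1r addrC.
rewrite (normZ nV) ler_wpM2l ?cabs_ge0 // hd //.
exact: (subspaceZ sF).
Qed.

Definition add_line (F : set V) (f : V) : set V :=
  [set y | exists a, F (y - a *: f)].

(** If x_k + a_k f converges with x_k in F, then [line_bound] makes the
coefficients a_k a Cauchy sequence, so they converge in R[i]. *)
Lemma add_line_closed (F : set V) f : subspace F -> norm_closed n F -> ~ F f ->
  norm_closed n (add_line F f).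
Proof.
move=> sF clF nFf y hy; have [E E0 hE] := line_bound sF clF nFf.
have {}hy k : exists ya : V * R[i],
    F (ya.1 - ya.2 *: f) /\ n (y - ya.1) <= 2^-1 ^+ k.
  have [y' [a Fa] le] := hy _ (half_gt0 k).
  by exists (y', a).
have [ya hya] := choice hy.
have E2 : 0 <= E * 2 by rewrite mulr_ge0.
have [|l hl] := complex_complete (u := fun k => (ya k).2) E2.
  move=> k; have [F1 h1] := hya k.+1; have [F0 h0] := hya k.
  have := hE _ ((ya k.+1).2 - (ya k).2) (subspaceB sF F1 F0).
  have -> : (ya k.+1).1 - (ya k.+1).2 *: f - ((ya k).1 - (ya k).2 *: f) +
      ((ya k.+1).2 - (ya k).2) *: f = (ya k.+1).1 - (ya k).1.
    by rewrite scalerBl opprB addrAC !subrKA.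
  move=> h; rewrite (le_trans h) // -mulrA ler_wpM2l //.
  rewrite (le_trans (norm_triB nV _ y _)) // (normB nV).
  by move: h0 h1 (@half_ge0 R k); rewrite halfS; lra.
exists l; apply: clF => e e0.
have [k hk] := half_small (1 + 4 * (E * 2) * n f) e0.
exists ((ya k).1 - (ya k).2 *: f); first by case: (hya k).
have -> : y - l *: f - ((ya k).1 - (ya k).2 *: f) =
    (y - (ya k).1) - (l - (ya k).2) *: f.
  by rewrite scalerBl !opprB addrACA [RHS]addrACA; congr (_ + _); rewrite addrC.
rewrite (le_trans _ hk) // mulrDl mul1r.
rewrite (le_trans (norm_triangle nV _ _)) // lerD //; first by case: (hya k).
by rewrite (normN nV) (normZ nV) mulrAC ler_wpM2r ?(norm_ge0 nV).
Qed.

Definition add_span (F : set V) p (f : 'I_p -> V) : set V :=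
  [set y | exists a : 'I_p -> R[i], F (y - \sum_i a i *: f i)].

Lemma subspace_add_span (F : set V) p (f : 'I_p -> V) :
  subspace F -> subspace (add_span F f).
Proof.
move=> sF; split.
  by exists (fun=> 0); rewrite big1 ?subr0 => [|i _]; [exact: sF.1|rewrite scale0r].
move=> a x y [b Fb] [c Fc]; exists (fun i => a * b i + c i).
have -> : a *: x + y - \sum_i (a * b i + c i) *: f i =
    a *: (x - \sum_i b i *: f i) + (y - \sum_i c i *: f i).
  rewrite scalerBr addrACA -opprD; congr (_ - _).
  rewrite scaler_sumr -big_split; apply: eq_bigr => i _ /=.
  by rewrite scalerDl scalerA.
exact: sF.2.
Qed.

(** Coefficients depend boundedly on the vector, and F plus a space of finite
dimension is closed. The two claims are proved together: the bound on one more
coefficient needs that F plus the span of the others is closed. *)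
Lemma free_bound (F : set V) p (f : 'I_p -> V) :
  subspace F -> norm_closed n F -> free_mod F f ->
  (exists2 E, 0 <= E & forall x (a : 'I_p -> R[i]), F x ->
     \sum_i cabs (a i) <= E * n (x + \sum_i a i *: f i)) /\
  norm_closed n (add_span F f).
Proof.
move=> sF clF; elim: p f => [|p IH] f ff.
  split; first by exists 0 => // x a Fx; rewrite big_ord0 mul0r.
  move=> y hy; exists (fun=> 0); rewrite big_ord0 subr0; apply: clF => e e0.
  by have [z [a]] := hy e e0; rewrite big_ord0 subr0 => Fz ?; exists z.
have ff' : free_mod F (f \o lift ord0).
  move=> a Fa i; have := ff (fcons 0 a) _ (lift ord0 i); rewrite fconsS; apply.
  rewrite big_ord_recl fcons0 scale0r add0r.
  by under eq_bigr => j _ do rewrite fconsS.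
have [[E' E'0 hE'] clF'] := IH _ ff'.
have sF' := subspace_add_span (f \o lift ord0) sF.
have nF'f : ~ add_span F (f \o lift ord0) (f ord0).
  move=> [a Fa]; have := ff (fcons 1 (fun i => - a i)) _ ord0.
  rewrite fcons0; suff h : F (\sum_i fcons 1 (fun i => - a i) i *: f i).
    by move=> /(_ h)/eqP; rewrite oner_eq0.
  rewrite big_ord_recl fcons0 scale1r.
  under eq_bigr => j _ do rewrite fconsS scaleNr.
  by rewrite sumrN.
have [E1 E10 hE1] := line_bound sF' clF' nF'f.
split.
  exists (E1 + E' * (1 + E1 * n (f ord0))).
    by rewrite addr_ge0 // mulr_ge0 // addr_ge0 // mulr_ge0 // (norm_ge0 nV).
  move=> x a Fx; rewrite !big_ord_recl /=.
  set s := \sum_i _ *: _; set N := n (x + _).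
  have h1 : cabs (a ord0) <= E1 * N.
    rewrite /N [a ord0 *: _ + _]addrC addrA; apply: hE1.
    by exists (fun i => a (lift ord0 i)); rewrite addrK.
  have h2 : n (x + s) <= N + cabs (a ord0) * n (f ord0).
    rewrite -(normZ nV) -(normN nV (a ord0 *: f ord0)).
    rewrite (le_trans _ (norm_triangle nV _ _)) //.
    by rewrite [a ord0 *: _ + s]addrC addrA addrK.
  have h3 := hE' x (fun i => a (lift ord0 i)) Fx.
  have h4 : cabs (a ord0) * n (f ord0) <= E1 * N * n (f ord0).
    by rewrite ler_wpM2r ?(norm_ge0 nV).
  have h5 : n (x + s) <= (1 + E1 * n (f ord0)) * N.
    rewrite mulrDl mul1r (le_trans h2) // lerD2l (le_trans h4) //.
    by rewrite mulrAC.
  rewrite mulrDl lerD // (le_trans h3) // -mulrA ler_wpM2l //.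
move=> y hy; have [|a [b Fb]] := add_line_closed sF' clF' nF'f (x := y).
  move=> e e0; have [z [a]] := hy e e0; rewrite big_ord_recl opprD addrA => Fz hz.
  by exists z => //; exists (a ord0); exists (fun i => a (lift ord0 i)).
exists (fcons a b); rewrite big_ord_recl fcons0 opprD addrA.
by under eq_bigr => i _ do rewrite fconsS.
Qed.

Lemma closed0 : norm_closed n [set 0].
Proof.
move=> x hx; apply/(norm_eq0 nV)/le_anti; rewrite (norm_ge0 nV) andbT.
apply/ler_addgt0Pl => e e0; have [y -> h] := hx e e0.
by rewrite addr0; rewrite subr0 in h.
Qed.

(** Riesz's lemma: normalise g - x0, where x0 in F realises the distance from g
to F up to a factor 2. *)
Lemma riesz (F G : set V) g : subspace F -> norm_closed n F -> subspace G ->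
  F `<=` G -> G g -> ~ F g ->
  exists u, [/\ G u, n u = 1 & forall x, F x -> 2^-1 <= n (u - x)].
Proof.
move=> sF clF sG FG Gg nFg; have [d d0 hd] := dist_gt0 clF nFg.
pose S := [set n (g - x) | x in F].
have S0 : S !=set0 by exists (n (g - 0)); exists 0 => //; exact: sF.1.
have lS : lbound S d by move=> _ [x Fx <-]; apply: hd.
have dS : 0 < inf S by rewrite (lt_le_trans d0) //; apply: lb_le_inf.
have [|_ [x0 Fx0 <-] hx0] := @inf_adherent _ S (inf S) dS.
  by split=> //; exists d.
have r0 : 0 < n (g - x0) by rewrite (lt_le_trans d0) ?hd.
pose c := real_complex R (n (g - x0)).
have c0 : c != 0 by rewrite fmorph_eq0 gt_eqF.
have ac : cabs c = n (g - x0) by rewrite cabs_real // ltW.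
exists (c^-1 *: (g - x0)); split.
- by apply: (subspaceZ sG); apply: (subspaceB sG) => //; apply: FG.
- by rewrite (normZ nV) cabsV ac mulVf // gt_eqF.
move=> x Fx.
have -> : c^-1 *: (g - x0) - x = c^-1 *: (g - (c *: x + x0)).
  by rewrite opprD addrCA [RHS]scalerDr scalerN scalerA mulVf // scale1r [LHS]addrC.
rewrite (normZ nV) cabsV ac mulrC ler_pdivlMr // ler_pdivrMl //.
have h : inf S <= n (g - (c *: x + x0)).
  apply: ge_inf; first by exists d.
  by exists (c *: x + x0) => //; apply: sF.2.
by rewrite (le_trans (ltW hx0)) //; lra.
Qed.

(** Choose unit vectors of G one after the other, each at distance at least 1/2
from the span of the preceding ones. The point is that the constant depends on
m only, not on G. It comes from the recursion c_0 = 0, c_(m+1) = 3 c_m + 2: if N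
is the norm of a_0 v + s, with v the new vector, then |a_0| <= 2 N, hence
|s| <= 3 N. *)
Lemma almost_orthonormal (G : set V) m : subspace G -> has_free G [set 0] m ->
  exists u : 'I_m -> V, (forall i, G (u i) /\ n (u i) = 1) /\
    forall a : 'I_m -> R[i],
      \sum_i cabs (a i) <= (3 ^+ m - 1) * n (\sum_i a i *: u i).
Proof.
move=> sG; elim: m => [|m IH] hG.
  exists (fun=> 0); split=> [[]//|a].
  by rewrite !big_ord0 expr0 subrr mul0r.
have [u [Gu hu]] := IH (has_freeS hG).
have fu : free_mod [set 0] u.
  move=> a a0 i; apply: cabs_eq0; apply/eqP.
  have := hu a; rewrite a0 (norm0 nV) mulr0 => h.
  have /eqP : \sum_i cabs (a i) = 0.
    by apply/le_anti; rewrite h sumr_ge0 // => j _; apply: cabs_ge0.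
  rewrite psumr_eq0 => [/allP/(_ i)|j _]; last exact: cabs_ge0.
  by rewrite mem_index_enum => /(_ isT).
have s0 := @subspace0 _ V.
have [_ clF] := free_bound s0 closed0 fu.
have sF := subspace_add_span u s0.
have [g Gg nFg] : exists2 g, G g & ~ add_span [set 0] u g.
  apply: contrapT => nex; apply: (span_not_free s0 _ hG (e := u)) => y Gy.
  by apply: contrapT => h; apply: nex; exists y.
have FG : add_span [set 0] u `<=` G.
  move=> y [a /= /eqP]; rewrite subr_eq0 => /eqP ->.
  by apply: (subspace_sum sG) => i; case: (Gu i).
have [v [Gv v1 hv]] := riesz sF clF sG FG Gg nFg.
exists (fcons v u); split=> [i|a].
  by rewrite /fcons; case: unliftP.
rewrite !big_ord_recl fcons0.
under [X in _ * n (_ + X)]eq_bigr => i _ do rewrite fconsS.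
set s := \sum_i _ *: _; set N := n _; set T := \sum_i cabs _.
have Fs : add_span [set 0] u s.
  by exists (fun i => a (lift ord0 i)); rewrite /= subrr.
have h1 : cabs (a ord0) <= 2 * N.
  have [->|a0] := eqVneq (a ord0) 0.
    by rewrite cabs0 mulr_ge0 // (norm_ge0 nV).
  have := hv (- (a ord0)^-1 *: s) (subspaceZ sF _ Fs).
  have -> : N = cabs (a ord0) * n (v - (- (a ord0)^-1 *: s)).
    rewrite -(normZ nV) scaleNr opprK scalerDr scalerA divff // scale1r.
    by [].
  have := cabs_gt0 a0; move: (cabs _) (n _) => x y x0 hy.
  have : x * 2^-1 <= x * y by rewrite ler_pM2l.
  lra.
have h2 : n s <= 3 * N.
  have : n s <= N + cabs (a ord0).
    have := norm_triangle nV (a ord0 *: v + s) (- (a ord0 *: v)).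
    by rewrite addrC addrA addNr add0r (normN nV) (normZ nV) v1 mulr1 addrC.
  lra.
have h3 : T <= (3 ^+ m - 1) * (3 * N).
  rewrite (le_trans (hu _)) // ler_wpM2l // subr_ge0 exprn_ege1 //; lra.
rewrite exprS; move: h1 h3; lra.
Qed.

(** If sum_i a_i w_i = 0, then sum_i a_i f_i = sum_i a_i (f_i - w_i) is at most
e sum_i |a_i|, too small for the lower bound unless all a_i vanish. *)
Lemma free_perturb m (f w : 'I_m -> V) E e :
  (forall a : 'I_m -> R[i], \sum_i cabs (a i) <= E * n (\sum_i a i *: f i)) ->
  0 <= E -> (forall i, n (f i - w i) <= e) -> E * e < 1 ->
  free_mod [set 0] w.
Proof.
move=> hE E0 fw Ee a /= a0 i; apply: cabs_eq0; apply/eqP.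
have h := hE a.
have : n (\sum_i a i *: f i) <= (\sum_i cabs (a i)) * e.
  have -> : \sum_i a i *: f i = \sum_i a i *: (f i - w i).
    by under [RHS]eq_bigr => j _ do rewrite scalerBr; rewrite sumrB a0 subr0.
  exact: norm_sum.
move=> /(ler_wpM2l E0)/(le_trans h) h'.
have T0 : 0 <= \sum_i cabs (a i) by rewrite sumr_ge0 // => j _; apply: cabs_ge0.
have /eqP : \sum_i cabs (a i) = 0.
  apply/le_anti; rewrite T0 andbT.
  move: h'; rewrite mulrCA => h'; nra.
rewrite psumr_eq0 => [/allP/(_ i)|j _]; last exact: cabs_ge0.
by rewrite mem_index_enum => /(_ isT).
Qed.

(** If every unit vector of G is within eta of F, an almost orthonormal family
of G is close to a family of F, which is free by [free_perturb]. *)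
Lemma not_free_gap (F G : set V) m eta : subspace G ->
  (forall u, G u -> exists2 v, F v & n (u - v) <= eta * n u) ->
  3 ^+ m * eta < 1 -> 0 <= eta ->
  ~ has_free F [set 0] m -> ~ has_free G [set 0] m.
Proof.
move=> sG gap small eta0 nF hG; apply: nF.
have [u [Gu hu]] := almost_orthonormal sG hG.
have {}gap i : exists v, F v /\ n (u i - v) <= eta.
  have [Gi n1] := Gu i; have [v Fv h] := gap _ Gi.
  by exists v; split=> //; rewrite n1 mulr1 in h.
have [v hv] := choice gap.
exists v; split=> [i|]; first by case: (hv i).
have hu' (a : 'I_m -> R[i]) :
    \sum_i cabs (a i) <= 3 ^+ m * n (\sum_i a i *: u i).
  by rewrite (le_trans (hu a)) // ler_wpM2r ?(norm_ge0 nV) // gerBl.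
apply: (free_perturb hu' _ (fun i => (hv i).2) small).
by rewrite exprn_ge0.
Qed.

End FiniteDimension.

(** * Kernels of perturbed operators *)
Section Perturbation.
Context {R : realType} {V W : lmodType R[i]} {n : V -> R} {p : W -> R}.
Hypotheses (nV : is_norm n) (nW : is_norm p).
Hypotheses (compV : fast_complete n) (compW : fast_complete p).
Variables (D P : {linear V -> W}) (B : R).
Hypotheses (B0 : 0 <= B) (DB : forall v, p (D v) <= B * n v).
Hypothesis Ple : forall v, p (P v) <= n v.

(** A solution v of D v = z solves the perturbed equation up to the error
l P v, of norm at most |l| C |z| <= |z| / 2. *)
Lemma perturbed_onto C : 0 <= C ->
  (forall z, exists2 v, D v = z & n v <= C * p z) ->
  forall l, cabs l * C <= 2^-1 ->
  forall z, exists2 v, D v - l *: P v = z & n v <= 2 * C * p z.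
Proof.
move=> C0 sol l lC z.
have B'0 : 0 <= B + cabs l by rewrite addr_ge0 ?cabs_ge0.
apply: (@solvable_of_approx _ _ _ _ _ nV nW (D \- l \*: P) setT (B + cabs l) C) => //.
  move=> v /=; rewrite (le_trans (norm_triangle nW _ _)) // (normN nW) mulrDl.
  by rewrite (normZ nW) lerD // ler_wpM2l ?cabs_ge0.
move=> y _; have [v <- nv] := sol y; exists v; split=> //=.
rewrite opprB addrCA subrr addr0 (normZ nW).
have h : cabs l * p (P v) <= cabs l * (C * p (D v)).
  by rewrite ler_wpM2l ?cabs_ge0 // (le_trans (Ple v)).
rewrite (le_trans h) // mulrA mulrC.
by rewrite ler_wpM2l // (norm_ge0 nW).
Qed.

(** With w a small solution of (D - l P) w = l P f_i, the vector f_i + w is in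
the kernel of D - l P. The bound on l depends on the family f, hence on m. *)
Lemma perturbed_ker_ge m : (forall z, exists v, D v = z) ->
  has_free [set v | D v = 0] [set 0] m ->
  exists2 e, 0 < e & forall l, cabs l < e ->
    (forall z, exists v, D v - l *: P v = z) /\
    has_free [set v | D v - l *: P v = 0] [set 0] m.
Proof.
move=> surj [f [Df ff]].
have rD z : range D z by have [v <-] := surj z; exists v.
have [C C0 hC] := open_mapping nV nW compV compW DB B0 (fun z _ => rD z).
have {}hC z : exists2 v, D v = z & n v <= C * p z by apply: hC.
have [[E E0 hE] _] := free_bound nV (@subspace0 _ V) (closed0 nV) ff.
pose M := \sum_i n (f i).
have M0 : 0 <= M by rewrite sumr_ge0 // => i _; apply: (norm_ge0 nV).
have fM i : n (f i) <= M.
  rewrite /M (bigD1 i) //= lerDl sumr_ge0 // => j _; exact: (norm_ge0 nV).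
have Q0 : 0 < 1 + 2 * C + 2 * C * M * E.
  by rewrite ltr_wpDr ?mulr_ge0 // ltr_wpDr ?mulr_ge0.
(* The terms 2 C and 2 C M E ensure that |l| C <= 1/2 and that the corrections
   are smaller than the tolerance 1 / E of [free_perturb]. *)
exists ((1 + 2 * C + 2 * C * M * E)^-1); first by rewrite invr_gt0.
move=> l; rewrite -[_^-1]mulr1 ltr_pdivlMl // => hl.
have l0 := cabs_ge0 l.
have lC : cabs l * C <= 2^-1.
  have := mulr_ge0 l0 (mulr_ge0 (mulr_ge0 C0 M0) E0); nra.
have onto := perturbed_onto C0 hC lC.
split=> [z|]; first by have [v <-] := onto z; exists v.
have corr i : exists w, D (f i + w) - l *: P (f i + w) = 0 /\
    n w <= 2 * C * cabs l * M.
  have [w Dw nw] := onto (l *: P (f i)); exists w; split.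
    rewrite !linearD /= (Df i : D _ = 0) add0r addrCA Dw.
    by rewrite addNr.
  rewrite (le_trans nw) // (normZ nW) -!mulrA !ler_wpM2l //.
  exact: le_trans (Ple _) (fM i).
have [w hw] := choice corr.
exists (fun i => f i + w i); split=> [i|]; first by case: (hw i).
apply: (free_perturb nV (E := E) (f := f) (e := 2 * C * cabs l * M)) => //.
- by move=> a; have := hE 0 a erefl; rewrite add0r.
- move=> i; rewrite opprD addrA subrr sub0r (normN nV); by case: (hw i).
have := mulr_ge0 l0 C0; nra.
Qed.

(** For u in the kernel of D - l P one has D u = l P u, so the open mapping
theorem gives v with D v = D u and |v| <= C |l| |u|, and u - v is in ker D. *)
Lemma perturbed_ker_le m : norm_closed p (range D) ->
  ~ has_free [set v | D v = 0] [set 0] m ->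
  exists2 e, 0 < e & forall l, cabs l < e ->
    ~ has_free [set v | D v - l *: P v = 0] [set 0] m.
Proof.
move=> clD nD.
have [C C0 hC] := open_mapping nV nW compV compW DB B0 clD.
have Q0 : 0 < 1 + 3 ^+ m * C by rewrite ltr_wpDr // mulr_ge0 // exprn_ge0.
exists ((1 + 3 ^+ m * C)^-1); first by rewrite invr_gt0.
move=> l; rewrite -[_^-1]mulr1 ltr_pdivlMl // => hl.
have l0 := cabs_ge0 l.
apply: (not_free_gap nV (F := [set v | D v = 0]) (eta := C * cabs l)) => //.
- exact: (subspace_ker (D \- l \*: P)).
- move=> u /= /eqP; rewrite subr_eq0 => /eqP Du.
  have [|v Dv nv] := hC (D u); first by exists u.
  exists (u - v); first by rewrite /= linearB Dv subrr.
  rewrite opprB addrCA subrr addr0 (le_trans nv) // Du (normZ nW) -mulrA.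
  by rewrite !ler_wpM2l.
- by rewrite mulrA; nra.
- exact: mulr_ge0.
Qed.

End Perturbation.

(** * The index of a bordered operator *)
Section AlgebraicIndex.
Context {K : numFieldType} {Y : lmodType K}.

(** The formula of [ind] for a map that is not bundled with a proof of
boundedness. *)
Definition alg_index (S : Y -> Y) : \bar int :=
  (dim [set y | S y = 0%R] - codim (range S))%E.

Definition shift_op (S : Y -> Y) (l : K) (y : Y) : Y := S y - l *: y.

Definition bordered (S : Y -> Y) p (f : 'I_p -> Y) (u : Y * 'rV[K]_p) : Y :=
  S u.1 + \sum_i u.2 0 i *: f i.

Section BorderedLinear.
Variables (S : {linear Y -> Y}) (p : nat) (f : 'I_p -> Y).

Fact bordered_linear : linear (bordered S f).
Proof.
move=> a x y; rewrite /bordered /= linearP scalerDr addrACA; congr (_ + _).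
rewrite scaler_sumr -big_split; apply: eq_bigr => i _.
by rewrite !mxE scalerDl scalerA.
Qed.

HB.instance Definition _ :=
  GRing.isLinear.Build K (Y * 'rV[K]_p)%type Y _ (bordered S f) bordered_linear.

End BorderedLinear.

Section Index.
Variables (S : {linear Y -> Y}) (p : nat) (f : 'I_p -> Y).
Local Notation D := (bordered S f).

Let I : set 'rV[K]_p := [set a | exists y, D (y, a) = 0].
Let kerS : set (Y * 'rV[K]_p) := [set u | u.2 = 0 /\ S u.1 = 0].

Let subspace_I : subspace I.
Proof.
split=> [|a x y [v Dv] [w Dw]]; first by exists 0; exact: linear0.
exists (a *: v + w).
by have /= := linearP D a (v, x) (w, y); rewrite Dv Dw scaler0 addr0.
Qed.

Let subspace_kerS : subspace kerS.
Proof.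
split=> [|a x y [/= x2 x1] [y2 y1]]; first by split=> //=; exact: linear0.
by split=> /=; rewrite ?linearP ?x1 ?y1 ?x2 ?y2 scaler0 addr0.
Qed.

(** Rank-nullity for the projection (y, a) |-> a on the kernel of D, whose
image is I and whose kernel is a copy of the kernel of S. *)
Let dim_ker_bordered :
  dim [set u | D u = 0] = (dim I + dim [set y | S y = 0%R])%E.
Proof.
have s0 (V : lmodType K) := @subspace0 K V.
have sS := subspace_ker S; have sD := subspace_ker D.
rewrite /dim (quotient_dimD (B := kerS)) //; last 2 first.
- by move=> x ->; split=> //; exact: linear0.
- move=> [y a] [/= -> Sy]; rewrite /bordered /= Sy add0r big1 // => i _.
  by rewrite mxE scale0r.
congr (_ + _)%E; apply/le_anti/andP; split.
- apply: (quotient_dim_transfer (Rel := fun u a => a = u.2)) => //.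
  + by move=> a x x' y y' -> ->.
  + by move=> [y a] Du; exists a => //; exists y.
  + move=> [y a] _ /= Du -> a0; move: Du; rewrite /kerS /= a0 => Du; split=> //.
    move: Du; rewrite /bordered /= big1 ?addr0 // => i _.
    by rewrite mxE scale0r.
- apply: (quotient_dim_transfer (Rel := fun a u => a = u.2 /\ D u = 0)) => //.
  + by split=> //; exact: linear0.
  + move=> a x x' y y' [-> h] [-> h']; split=> //.
    by have /= -> := linearP D a x' y'; rewrite h h' scaler0 addr0.
  + by move=> a [y Da]; exists (y, a).
  + by move=> a u _ [-> _] [].
- apply: (quotient_dim_transfer (Rel := fun u y => u = (y, 0))) => //.
  + move=> a x x' y y' -> ->; congr pair.
    by rewrite /= scaler0 addr0.
  + by move=> [y a] [/= -> Sy]; exists y.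
  + by move=> u y _ -> ->.
- apply: (quotient_dim_transfer (Rel := fun y u => u = (y, 0))) => //.
  + move=> a x x' y y' -> ->; congr pair.
    by rewrite /= scaler0 addr0.
  + by move=> y Sy; exists (y, 0).
  + by move=> y u _ -> [].
Qed.

(** The map a |-> sum_i a_i f_i embeds the quotient of K^p by I into the
cokernel of S; this is an isomorphism when D is onto. *)
Let codim_I_le : (codim I <= codim (range S))%E.
Proof.
have sR := subspace_range S; rewrite /codim.
apply: (quotient_dim_transfer (Rel := fun (a : 'rV[K]_p) y =>
  y = \sum_i a 0 i *: f i)) => //.
- by rewrite big1 // => i _; rewrite mxE scale0r.
- move=> a x x' y y' -> ->; rewrite scaler_sumr -big_split.
  by apply: eq_bigr => i _; rewrite !mxE scalerDl scalerA.
- by move=> a _; exists (\sum_i a 0 i *: f i).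
- move=> a _ _ -> [y _ Sy]; exists (- y).
  by rewrite /bordered /= linearN Sy addNr.
Qed.

Let codim_I_ge : (forall z, exists u, D u = z) ->
  (codim (range S) <= codim I)%E.
Proof.
move=> surj; have sR := subspace_range S; rewrite /codim.
apply: (quotient_dim_transfer (Rel := fun y a => exists t, D (t, a) = y)) => //.
- by exists 0; exact: linear0.
- move=> a x x' y y' [v Dv] [w Dw]; exists (a *: v + w).
  by have /= := linearP D a (v, x') (w, y'); rewrite Dv Dw.
- by move=> y _; have [[t a] Dt] := surj y; exists a => //; exists t.
- move=> y a _ [t <-] [v Dv]; exists (t - v) => //.
  have /= := linearB D (t, a) (v, a); rewrite Dv subr0 => <-.
  rewrite /bordered /= big1 ?addr0 // => i _.
  by rewrite !mxE subrr scale0r.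
Qed.

(** With r = dim I and q = p - r, one has dim (ker D) = r + dim (ker S) and
q <= codim (range S), so ind S <= dim (ker S) - q = dim (ker D) - p. *)
Lemma alg_index_le :
  (alg_index S <= dim [set u | D u = 0%R] - (p%:Z)%:E)%E.
Proof.
have sS := subspace_ker S; have sR := subspace_range S.
have s0 (V : lmodType K) := @subspace0 K V.
have := @dim_rV K p; rewrite dim_ker_bordered /alg_index /dim /codim.
rewrite (quotient_dimD (B := I)) //; last by move=> _ ->; exact: subspace_I.1.
move: codim_I_le; rewrite /codim.
case: (quotient_dimP (subspaceT _) subspace_I) => [q e _|_]; last first.
  by case: (quotient_dimP subspace_I (s0 _)).
case: (quotient_dimP subspace_I (s0 _)) => // r e' _ hc [<-].
case: (quotient_dimP sS (s0 _)) => [k e'' _|_]; last by rewrite leey.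
move: hc; case: (quotient_dimP (subspaceT _) sR) => [c e3 _|_]; last by rewrite leNye.
by rewrite !lee_fin; lia.
Qed.

Lemma alg_index_eq : (forall z, exists u, D u = z) ->
  alg_index S = (dim [set u | D u = 0%R] - (p%:Z)%:E)%E.
Proof.
move=> surj; have hle := codim_I_le; have hge := codim_I_ge surj.
have -> : alg_index S = (dim [set y | S y = 0%R] - codim I)%E.
  by rewrite /alg_index; congr (_ - _)%E; apply/le_anti; rewrite hle hge.
have sS := subspace_ker S; have s0 (V : lmodType K) := @subspace0 K V.
have := @dim_rV K p; rewrite dim_ker_bordered /dim /codim.
rewrite (quotient_dimD (B := I)) //; last by move=> _ ->; exact: subspace_I.1.
case: (quotient_dimP (subspaceT _) subspace_I) => [q e _|_]; last first.
  by case: (quotient_dimP subspace_I (s0 _)).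
case: (quotient_dimP subspace_I (s0 _)) => // r e' _ [<-].
case: (quotient_dimP sS (s0 _)) => [k e'' _|_] //.
by congr EFin; lia.
Qed.

End Index.
End AlgebraicIndex.

(** * Stability of the index *)
Section Banach.
Context {R : realType}.

Lemma nrm_norm (X : normedModType R[i]) : is_norm (@nrm R X).
Proof.
split=> [x x0|x y|a x].
- by apply/eqP; rewrite -normr_eq0 nrmE x0.
- by rewrite -lecR rmorphD /= -!nrmE ler_normD.
- by apply: (@complexI R); rewrite rmorphM /= -!nrmE normrZ.
Qed.

Lemma closed_norm_closed (X : normedModType R[i]) (F : set X) :
  closed F -> norm_closed (@nrm R X) F.
Proof.
move=> clF x hx; apply: clF => U /nbhs_ballP[e /= e0 eU].
have ee : e = real_complex R (complex.Re e) by rewrite RRe_real // gtr0_real.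
have [|y Fy xy] := hx (complex.Re e / 2).
  by rewrite divr_gt0 // -ltcR -ee.
exists y; split=> //; apply: eU; rewrite -ball_normE /= ee nrmE ltcR.
rewrite (le_lt_trans xy) //.
have : 0 < complex.Re e by rewrite -ltcR -ee.
lra.
Qed.

Lemma banach_fast_complete (X : completeNormedModType R[i]) :
  fast_complete (@nrm R X).
Proof.
move=> u hu; have nX := nrm_norm X.
have tail := fast_tail_le nX hu.
have cu : cauchy (u @ \oo).
  apply: cauchy_exP => e e0.
  have ee : e = real_complex R (complex.Re e) by rewrite RRe_real // gtr0_real.
  have re0 : 0 < complex.Re e by rewrite -ltcR -ee.
  have [k hk] := half_small 2 (divr_gt0 re0 (ltr0Sn R 1)).
  exists (u k); exists k => // j /= kj.
  rewrite -ball_normE /= ee nrmE ltcR (normB nX) -(subnKC kj).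
  rewrite (le_lt_trans (tail _ _)) // (le_lt_trans hk) //; lra.
have /cvg_ex[/= l /cvgrPdist_lt ul] : cvg (u @ \oo) by apply: cauchy_cvg.
exists l => k; apply/ler_addgt0Pr => e e0.
have e0' : 0 < real_complex R e by rewrite ltcR.
have [N _ hN] := ul _ e0'.
have := hN (N + k)%N (leq_addr _ _); rewrite /= nrmE ltcR => h.
rewrite [_ + e]addrC (le_trans (norm_triB nX _ (u (N + k)%N) _)) //.
by apply: lerD; [exact: ltW|rewrite addnC].
Qed.

Section ProductNorm.
Context {Y : completeNormedModType R[i]} {p : nat}.

(** A sum norm, for which the projection to Y is contractive and coordinates
can be estimated one at a time. *)
Definition pnorm (u : Y * 'rV[R[i]]_p) : R :=
  nrm u.1 + \sum_i cabs (u.2 0 i).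

Lemma pnorm_norm : is_norm pnorm.
Proof.
have nY := nrm_norm Y.
have s0 (a : 'rV[R[i]]_p) : 0 <= \sum_i cabs (a 0 i).
  by rewrite sumr_ge0 // => i _; apply: cabs_ge0.
split=> [[y a]|x y|a x]; rewrite /pnorm /=.
- move=> /eqP; rewrite paddr_eq0 ?(norm_ge0 nY) ?s0 // => /andP[/eqP y0].
  rewrite psumr_eq0 => [/allP a0|i _]; last exact: cabs_ge0.
  congr pair; first exact: (norm_eq0 nY).
  apply/rowP => i; rewrite mxE; apply/cabs_eq0/eqP.
  exact: (implyP (a0 i (mem_index_enum i))).
- rewrite addrACA lerD ?(norm_triangle nY) // -big_split ler_sum // => i _.
  by rewrite mxE cabsD.
- rewrite (normZ nY) mulrDr mulr_sumr; congr (_ + _).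
  by apply: eq_bigr => i _; rewrite mxE cabsM.
Qed.

(** Coordinatewise limits converge at a rate 2^-k with a factor that depends on
p; the factor 2 then follows from the triangle inequality, by comparison with a
far term of the sequence. *)
Lemma pnorm_complete : fast_complete pnorm.
Proof.
move=> u hu; have nY := nrm_norm Y.
have s0 (a : 'rV[R[i]]_p) : 0 <= \sum_i cabs (a 0 i).
  by rewrite sumr_ge0 // => i _; apply: cabs_ge0.
have [|y hy] := @banach_fast_complete Y (fun k => (u k).1).
  by move=> k; rewrite (le_trans _ (hu k)) // /pnorm /= lerDl.
have /choice[a ha] i : exists l, forall k,
    cabs (l - (u k).2 0 i) <= 4 * 1 * 2^-1 ^+ k.
  apply: (@complex_complete R (fun k => (u k).2 0 i)) => // k.
  rewrite mul1r (le_trans _ (hu k)) // /pnorm /= (bigD1 i) //= !mxE addrCA lerDl.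
  by rewrite addr_ge0 ?(norm_ge0 nY) // sumr_ge0 // => j _; apply: cabs_ge0.
pose l : Y * 'rV[R[i]]_p := (y, \row_i a i).
have hl k : pnorm (l - u k) <= (2 + 4 * p%:R) * 2^-1 ^+ k.
  rewrite /pnorm mulrDl lerD //= [4 * _]mulrC -mulrA mulr_natl.
  rewrite -[X in _ *+ X]card_ord -sumr_const ler_sum // => i _.
  by rewrite !mxE (le_trans (ha i k)) // mulr1.
have nP := pnorm_norm.
exists l => k; apply: (@le_half_eps _ _ _ (2 + 4 * p%:R)) => m.
rewrite [leRHS]addrC (le_trans (norm_triB nP _ (u (k + m)%N) _)) // lerD //.
  apply: (le_trans (hl _)); rewrite ler_wpM2l ?addr_ge0 ?mulr_ge0 //.
  by rewrite exprD ler_piMl ?half_ge0 // exprn_ile1 //; lra.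
exact: fast_tail_le.
Qed.

End ProductNorm.

Section Stability.
Context {Y : completeNormedModType R[i]}.
Variable A : 'L(Y).

Let nY := nrm_norm Y.

Lemma bounded_nrm : exists2 c, 0 <= c & forall y, nrm (A y) <= c * nrm y.
Proof.
have [c hc] := bop_bounded A; exists (cabs c); first exact: cabs_ge0.
move=> y; have := hc y; rewrite !nrmE lecE => /andP[_ /=].
case: c {hc} => a b /=; rewrite mulr0 subr0 => h; rewrite (le_trans h) //.
rewrite ler_wpM2r ?(norm_ge0 nY) // (le_trans (ler_norm _)) //.
exact: (Re_le_cabs (Complex a b)).
Qed.

Section Border.
Variables (p : nat) (f : 'I_p -> Y).
Local Notation D := (bordered A f).
Local Notation U := (Y * 'rV[R[i]]_p)%type.

Lemma bordered_bounded :
  exists2 B, 0 <= B & forall u, nrm (D u) <= B * pnorm u.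
Proof.
have [c c0 hc] := bounded_nrm.
pose M := \sum_i nrm (f i).
have M0 : 0 <= M by rewrite sumr_ge0 // => i _; apply: (norm_ge0 nY).
have fM i : nrm (f i) <= M.
  by rewrite /M (bigD1 i) //= lerDl sumr_ge0 // => j _; exact: (norm_ge0 nY).
exists (c + M); first exact: addr_ge0.
move=> [y a]; rewrite /bordered /pnorm /=.
rewrite (le_trans (norm_triangle nY _ _)) //.
have := norm_sum nY (fun i => a 0 i) fM; have := hc y.
have : 0 <= \sum_i cabs (a 0 i) by rewrite sumr_ge0 // => i _; apply: cabs_ge0.
have := norm_ge0 nY y; nra.
Qed.

Lemma bordered_shift l (u : U) : bordered (shift_op A l) f u = D u - l *: u.1.
Proof. by rewrite /bordered /shift_op addrAC. Qed.

Lemma fst_le (u : U) : nrm u.1 <= pnorm u.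
Proof.
by rewrite lerDl sumr_ge0 // => i _; apply: cabs_ge0.
Qed.

Lemma ker_bordered_shift l :
  [set u | bordered (shift_op A l) f u = 0] = [set u : U | D u - l *: u.1 = 0].
Proof. by apply/seteqP; split=> u /=; rewrite bordered_shift. Qed.

Lemma index_lower_bordered m : (forall z, exists u, D u = z) ->
  has_free [set u | D u = 0] [set 0] m ->
  exists2 e, 0 < e & forall l, cabs l < e ->
    ((m%:Z)%:E - (p%:Z)%:E <= alg_index (shift_op A l))%E.
Proof.
move=> surj free; have [B B0 DB] := bordered_bounded.
have [e e0 he] := @perturbed_ker_ge R U Y (@pnorm Y p) (@nrm R Y) pnorm_norm nY
  pnorm_complete (@banach_fast_complete Y) (bordered A f) fst B B0 DB fst_le
  m surj free.
exists e => // l /he[surjl freel].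
rewrite (@alg_index_eq _ _ (A \- l \*: idfun) _ f); last first.
  by move=> z; have [u <-] := surjl z; exists u; rewrite -bordered_shift.
apply: leeB => //; apply/le_quotient_dim.
- exact: (subspace_ker (bordered (A \- l \*: idfun) f)).
- exact: subspace0.
move: freel; rewrite -(ker_bordered_shift l); exact.
Qed.

Lemma index_upper_bordered m : norm_closed (@nrm R Y) (range D) ->
  ~ has_free [set u | D u = 0] [set 0] m.+1 ->
  exists2 e, 0 < e & forall l, cabs l < e ->
    (alg_index (shift_op A l) <= (m%:Z)%:E - (p%:Z)%:E)%E.
Proof.
move=> clD nfree; have [B B0 DB] := bordered_bounded.
have [e e0 he] := @perturbed_ker_le R U Y (@pnorm Y p) (@nrm R Y) pnorm_norm nY
  pnorm_complete (@banach_fast_complete Y) (bordered A f) fst B B0 DB fst_le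
  m.+1 clD nfree.
exists e => // l /he nl.
apply: (le_trans (@alg_index_le _ _ (A \- l \*: idfun) _ f)).
apply: leeB => //.
have sD := subspace_ker (bordered (A \- l \*: idfun) f).
rewrite -ker_bordered_shift in nl.
rewrite /dim; case: (quotient_dimP sD (@subspace0 _ _)) => [k e' be|inf].
  rewrite lee_fin lez_nat leqNgt; apply/negP => mk; apply: nl.
  exact/(basis_has_free _ sD (@subspace0 _ _) be).
by case: nl; apply: inf.
Qed.

End Border.

(** An index that is bounded below by an integer forces the codimension p to be
finite. If the kernel is infinite-dimensional, any number m of independent
vectors can be used, and m is chosen large enough for j. *)
Lemma index_shift_lower (j : int) : (j%:E <= alg_index A)%E ->
  exists2 e, 0 < e & forall l, cabs l < e -> (j%:E <= alg_index (shift_op A l))%E.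
Proof.
have sk := subspace_ker A; have sr := subspace_range A.
have s0 := @subspace0 _ Y.
rewrite {1}/alg_index /codim.
case: (quotient_dimP (subspaceT Y) sr) => [p f bf|_]; last first.
  by case: dim.
move=> hj.
have [m [hm jm]] : exists m : nat,
    has_free [set y | A y = 0] [set 0] m /\ j <= m%:Z - p%:Z.
  move: hj; rewrite /dim; case: (quotient_dimP sk s0) => [k g bg|inf].
    rewrite lee_fin => hj; exists k; split=> //.
    exact/(basis_has_free _ sk s0 bg).
  by move=> _; exists (absz j + p)%N; split=> //; lia.
have surj z : exists u, bordered A f u = z.
  have [a [[t _ At] _]] := bf.2 z I.
  by exists (t, a); rewrite /bordered /= At subrK.
have hm' : has_free [set u | bordered A f u = 0] [set 0] m.
  apply: (has_free_transfer (Rel := fun y u => u = (y, 0))) hm => //.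
  - by move=> a x x' y y' -> ->; congr pair; rewrite /= scaler0 addr0.
  - move=> y Ay; exists (y, 0) => //.
    rewrite /bordered /= (Ay : A y = 0) add0r big1 // => i _.
    by rewrite mxE scale0r.
  - by move=> y u _ -> [].
have [e e0 he] := index_lower_bordered surj hm'.
exists e => // l /he; apply: le_trans; by rewrite lee_fin.
Qed.

(** The kernel has a finite dimension k. If the codimension is finite, f is a
basis of the cokernel and D is onto. Otherwise the range of A is closed, hence
so is that of D by [free_bound], and p can be taken as large as j requires. *)
Lemma index_shift_upper (j : int) : semi_fredholm A -> (alg_index A <= j%:E)%E ->
  exists2 e, 0 < e & forall l, cabs l < e -> (alg_index (shift_op A l) <= j%:E)%E.
Proof.
have sk := subspace_ker A; have sr := subspace_range A.
have s0 := @subspace0 _ Y.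
move=> sF hj.
have [k [p [f [nk ff clD kp]]]] : exists (k p : nat) (f : 'I_p -> Y),
    [/\ ~ has_free [set y | A y = 0] [set 0] k.+1, free_mod (range A) f,
     norm_closed (@nrm R Y) (range (bordered A f)) & k%:Z - p%:Z <= j].
  move: hj sF; rewrite /semi_fredholm /upper_semi_fredholm /lower_semi_fredholm.
  rewrite /alg_index /ker /dim /codim.
  case: (quotient_dimP sk s0) => [k g bg|_].
    have nk : ~ has_free [set y | A y = 0] [set 0] k.+1.
      exact: basis_not_free bg.
    case: (quotient_dimP (subspaceT Y) sr) => [p f bf|inf].
      rewrite lee_fin => kp _; exists k, p, f; split=> //.
        exact: basis_free bf.
      move=> z _; have [a [[t _ At] _]] := bf.2 z I.
      by exists (t, a) => //; rewrite /bordered /= At subrK.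
    move=> _ [[clR _]|]; last by rewrite ltxx.
    have [f [_ ff]] := inf (k + absz j)%N.
    exists k, (k + absz j)%N, f; split=> //; last by lia.
    have [_] := free_bound nY sr (closed_norm_closed clR) ff.
    congr (norm_closed _ _); apply/seteqP; split=> y.
      move=> [a [t _ At]]; exists (t, \row_i a i) => //.
      rewrite /bordered /= At; under [X in _ + X]eq_bigr => i _ do rewrite mxE.
      by rewrite subrK.
    move=> [[t a] _ <-]; exists (fun i => a 0 i); exists t => //.
    by rewrite /bordered /= addrK.
  case: (quotient_dimP (subspaceT Y) sr) => [p f bf|inf] //.
  by move=> _ [[_]|]; rewrite ltxx.
have nk' : ~ has_free [set u | bordered A f u = 0] [set 0] k.+1.
  move=> h; apply: nk.
  apply: (has_free_transfer (Rel := fun u y => y = u.1)) h => //.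
  - exact: (subspace_ker (bordered A f)).
  - by move=> a x x' y y' -> ->.
  - have a0 y a : bordered A f (y, a) = 0 -> a = 0.
      rewrite /bordered /= => /eqP; rewrite addrC addr_eq0 => /eqP ea.
      apply/rowP => i; rewrite mxE; apply: (ff (fun i => a 0 i)).
      by rewrite ea; exists (- y); rewrite ?linearN.
    move=> [y a] /= Da; exists y => //=.
    have a00 := a0 _ _ Da; move: Da; rewrite a00 /bordered /= big1 ?addr0 // => i _.
    by rewrite mxE scale0r.
  - move=> [y a] _ /= Da -> y0; congr pair => //.
    apply/rowP => i; rewrite mxE; apply: (ff (fun i => a 0 i)).
    move: Da; rewrite /bordered /= y0 linear0 add0r => ->.
    exact: (subspace_range A).1.
have [e e0 he] := index_upper_bordered clD nk'.
exists e => // l /he/le_trans; apply; by rewrite lee_fin.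
Qed.

End Stability.

End Banach.

(** * Decompositions with a quasi-nilpotent summand *)
Section Decomposition.
Context {R : realType} {X : completeNormedModType R[i]} (T : 'L(X)).

Local Notation shifted := (shift_op T).

Lemma shiftedP l a x y :
  shifted l (a *: x + y) = a *: shifted l x + shifted l y.
Proof. exact: (linearP (T \- l \*: idfun)). Qed.

Lemma shifted_invariant (M : closed_subspace X) l x :
  invariant_subspace T M -> csub_set M x -> csub_set M (shifted l x).
Proof.
move=> invM Mx; rewrite /shift_op addrC -scaleNr; apply: csubP => //.
by apply: invM; exists x.
Qed.

Lemma quasi_nilpotent_bij (N : closed_subspace X) (invN : invariant_subspace T N) l :
  quasi_nilpotent (restr T invN) -> l != 0 ->
  (forall x, csub_set N x -> shifted l x = 0 -> x = 0) /\
  (forall x, csub_set N x -> exists2 y, csub_set N y & shifted l y = x).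
Proof.
move=> [specN|N0] l0; last first.
  have {}N0 x : csub_set N x -> x = 0.
    by move=> Nx; have := N0 (CsubType (mem_set Nx)) => /(congr1 val).
  split=> x /N0 -> //; exists 0; first exact: csub0.
  by rewrite /shift_op linear0 scaler0 subr0.
have [G [GS SG]] : exists G : 'L(csub_type N),
    (forall y, G (l *: y - restr T invN y) = y) /\
    (forall y, l *: G y - restr T invN (G y) = y).
  apply: contrapT => nG; have : spectrum (restr T invN) l by [].
  by rewrite specN => /eqP; rewrite (negbTE l0).
split=> x Nx.
  move=> /eqP; rewrite subr_eq0 => /eqP Tx.
  pose y : csub_type N := CsubType (mem_set Nx).
  have : l *: y - restr T invN y = 0.
    by apply: val_inj; rewrite /= Tx subrr.
  move=> h; have := GS y; rewrite h linear0 => /(congr1 val) /=.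
  by move=> <-.
pose y : csub_type N := CsubType (mem_set Nx).
exists (val (- G y)); first exact: set_mem (valP (- G y)).
have /(congr1 val) /= := SG y => <-.
by rewrite /shift_op linearN scalerN opprK addrC.
Qed.

Lemma subspace_csub (M : closed_subspace X) : subspace M.
Proof. by split; [exact: csub0|move=> a x y; exact: csubP]. Qed.

Section Sum.
Variables (M N : closed_subspace X).
Hypotheses (invM : invariant_subspace T M) (invN : invariant_subspace T N).
Hypothesis MN0 : M `&` N = [set 0].
Local Notation Z := (sum_set M N).

Lemma subspace_sum_set : subspace Z.
Proof.
split; first by exists 0; [exact: csub0|exists 0; [exact: csub0|rewrite addr0]].
move=> a _ _ [m Mm [n Nn <-]] [m' Mm' [n' Nn' <-]].
exists (a *: m + m'); first exact: csubP.
exists (a *: n + n'); first exact: csubP.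
by rewrite scalerDr addrACA.
Qed.

Lemma subspace_shifted_image l (U : set X) : subspace U ->
  subspace (shifted l @` U).
Proof.
move=> sU; split.
  by exists 0; [exact: sU.1|rewrite /shift_op linear0 scaler0 subr0].
move=> a _ _ [x Ux <-] [y Uy <-]; exists (a *: x + y); first exact: sU.2.
exact: shiftedP.
Qed.

Lemma subspace_shifted_ker l (U : set X) : subspace U ->
  subspace [set x | U x /\ shifted l x = 0].
Proof.
move=> sU; split.
  by split; [exact: sU.1|rewrite /shift_op linear0 scaler0 subr0].
move=> a x y [Ux lx] [Uy ly]; split; first exact: sU.2.
by rewrite shiftedP lx ly scaler0 addr0.
Qed.

(** Kernels: if T - l kills m + n, then (T - l) m = - (T - l) n is in M and in
N, hence both vanish and n = 0. Cokernels: modulo (T - l) Z, which contains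
(T - l) N = N, the vector m + n equals m. The right-hand side depends on M and N
only through their sum. *)
Lemma alg_index_restr l :
  (forall x, csub_set N x -> shifted l x = 0 -> x = 0) ->
  (forall x, csub_set N x -> exists2 y, csub_set N y & shifted l y = x) ->
  alg_index (shift_op (restr T invM) l) =
  (dim [set x | Z x /\ shifted l x = 0%R] -
   quotient_dim Z (shifted l @` Z))%E.
Proof.
move=> injN surjN.
have disj x : csub_set M x -> csub_set N x -> x = 0.
  by move=> Mx Nx; have : (M `&` N) x by []; rewrite MN0.
have valM (y : csub_type M) : csub_set M (val y) by exact: set_mem (valP y).
have valS y : val (shift_op (restr T invM) l y) = shifted l (val y) by [].
have ZM x : csub_set M x -> Z x.
  by move=> Mx; exists x => //; exists 0; [exact: csub0|rewrite addr0].
have sZ := subspace_sum_set.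
have sk := subspace_ker (restr T invM \- l \*: idfun).
have sr := subspace_range (restr T invM \- l \*: idfun).
have s0X := @subspace0 _ X; have s0M := @subspace0 _ (csub_type M).
have sZk := subspace_shifted_ker l sZ; have sZi := subspace_shifted_image l sZ.
have shD m n : shifted l (m + n) = shifted l m + shifted l n.
  by have := shiftedP l 1 m n; rewrite !scale1r.
rewrite /alg_index /dim /codim; congr (_ - _)%E; apply/le_anti/andP; split.
- apply: (quotient_dim_transfer (Rel := fun y x => x = val y)) => //.
  + by move=> a x x' y y' -> ->.
  + move=> y /= Sy; exists (val y) => //; split; first exact: (ZM _ (valM y)).
    by rewrite -valS Sy.
  + by move=> y x _ -> /= y0; apply: val_inj.
- apply: (quotient_dim_transfer (Rel := fun x (y : csub_type M) => x = val y)) => //.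
  + by move=> a x x' y y' -> ->.
  + move=> _ [[m Mm [n Nn <-]]]; rewrite shD => /eqP; rewrite addr_eq0 => /eqP h.
    have mn0 : shifted l m = 0.
      apply: disj; first exact: shifted_invariant.
      rewrite h; apply: (subspaceN (subspace_csub N)); exact: shifted_invariant.
    have n0 : n = 0.
      by apply: injN => //; rewrite -[LHS]opprK -h mn0 oppr0.
    exists (CsubType (mem_set Mm)); last by rewrite n0 addr0.
    by apply: val_inj; rewrite valS.
  + by move=> x y _ -> /= ->.
- apply: (quotient_dim_transfer (Rel := fun y x => x = val y)) => //.
  + by move=> a x x' y y' -> ->.
  + by move=> y _; exists (val y) => //; exact: (ZM _ (valM y)).
  + move=> y x _ -> /= [_ [m Mm [n Nn <-]]]; rewrite shD => h.
    exists (CsubType (mem_set Mm)) => //; apply: val_inj; rewrite valS /=.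
    rewrite -h; suff -> : shifted l n = 0 by rewrite addr0.
    apply: disj; last exact: shifted_invariant.
    rewrite -[shifted l n](addKr (shifted l m)) addrC h.
    apply: (subspaceB (subspace_csub M)); first exact: (valM y).
    exact: shifted_invariant.
- apply: (quotient_dim_transfer (Rel := fun x (y : csub_type M) => csub_set N (x - val y))) => //.
  + by rewrite /= subr0; exact: csub0.
  + move=> a x x' y y' Nx Ny /=.
    rewrite opprD addrACA -scalerBr; exact: csubP.
  + move=> _ [m Mm [n Nn <-]]; exists (CsubType (mem_set Mm)) => //=.
    by rewrite addrC addKr.
  + move=> x y _ Nxy [t _ ty]; have [n Nn hn] := surjN _ Nxy.
    exists (val t + n); first by exists (val t); [exact: (valM t)|exists n].
    by rewrite shD hn -ty -valS addrC subrK.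
Qed.

End Sum.

(** Two integers j < j + 1 separate the indices, and both inequalities persist
for T - l with one common small l <> 0, where the two indices agree. *)
Lemma index_le (M N M' N' : closed_subspace X)
    (invM : invariant_subspace T M) (invN : invariant_subspace T N)
    (invM' : invariant_subspace T M') (invN' : invariant_subspace T N') :
  M `&` N = [set 0] -> M' `&` N' = [set 0] ->
  sum_set M N = sum_set M' N' ->
  semi_fredholm (restr T invM) ->
  quasi_nilpotent (restr T invN) -> quasi_nilpotent (restr T invN') ->
  (ind (restr T invM') <= ind (restr T invM))%E.
Proof.
move=> MN MN' ZZ sF qN qN'; rewrite leNgt; apply/negP => lt.
have [j [jM jM']] : exists j : int,
    (ind (restr T invM) <= j%:E)%E /\ ((j + 1)%:E <= ind (restr T invM'))%E.
  move: lt; case: (ind _) => [a||]; case: (ind _) => [b||] //.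
  - by rewrite lte_fin => ab; exists a; rewrite !lee_fin; split=> //; lia.
  - by exists a; rewrite leey.
  - by exists (b - 1); rewrite subrK leNye.
  - by exists 0; rewrite leey leNye.
have [e e0 he] := index_shift_upper sF jM.
have [e' e0' he'] := index_shift_lower jM'.
pose r := Num.min e e' / 2.
have m0 : 0 < Num.min e e' by rewrite lt_min e0.
have r0 : 0 < r by rewrite divr_gt0.
have rm : r < Num.min e e' by rewrite /r; lra.
pose l := real_complex R r.
have l0 : l != 0 by rewrite fmorph_eq0 gt_eqF.
have al : cabs l = r by rewrite cabs_real // ltW.
move: rm; rewrite lt_min -al => /andP[/he h /he' h'].
have [i1 s1] := quasi_nilpotent_bij qN l0.
have [i2 s2] := quasi_nilpotent_bij qN' l0.
rewrite (alg_index_restr invM invN MN i1 s1) in h.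
rewrite (alg_index_restr invM' invN' MN' i2 s2) -ZZ in h'.
by have := le_trans h' h; rewrite lee_fin; lia.
Qed.

End Decomposition.

Theorem lemma2p1 (R : realType) (X : completeNormedModType R[i]) (T : 'L(X))
    (M N M' N' : closed_subspace X)
    (invM : invariant_subspace T M) (invN : invariant_subspace T N)
    (invM' : invariant_subspace T M') (invN' : invariant_subspace T N') :
  infinite_dimensional X ->
  M `&` N = [set 0] -> M' `&` N' = [set 0] ->
  sum_set M N = sum_set M' N' -> closed (sum_set M N) ->
  semi_fredholm (restr T invM) -> semi_fredholm (restr T invM') ->
  quasi_nilpotent (restr T invN) -> quasi_nilpotent (restr T invN') ->
  ind (restr T invM) = ind (restr T invM').
Proof.
move=> _ MN MN' ZZ _ sF sF' qN qN'; apply/le_anti/andP; split.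
  exact: index_le (esym ZZ) sF' qN' qN.
exact: index_le ZZ sF qN qN'.
Qed.
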